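(* Let $\{X(t)\}_{t \in [0,1]}$ be a collection of random elements in $\mathbb{D}$ defined on the same probability space $(\Omega,\mathcal{F},P)$ such that: a) there exist $\alpha >1/2$, $\beta\geq 0$ and a non-decreasing continuous function $F$ on $[0,1]$ such that for any $t_1,t,t_2 \in [0,1]$ with $t_1 \leq t \leq t_2$ and for any $\lambda>0$, $$P\big(\|X(t)-X(t_1)\| \wedge \|X(t_2)-X(t)\| \geq \lambda \big) \leq \frac{1}{\lambda^{4\beta}} [F(t_2)-F(t_1)]^{2\alpha};$$ b) for any $\varepsilon>0$, $$\lim_{\delta \to 0} \limsup_{n\to \infty} P\big(w'(X(i/2^{n}), \delta)\geq \varepsilon \text{ for some integer } 0\leq i\leq 2^{n} \big)=0;$$ c) for any $t \in [0,1)$ and for any sequence $(t_n)_{n \geq 1}$ in $[0,1]$ with $t_n \to t$ and $t_{n+1} \leq t_n$ for any $n\geq 1$, $d_{J_1}^0\big(X(t_n),X(t)\big) \to 0$ in probability. Then there exists a collection $\{Y(t)\}_{t \in [0,1]}$ of random elements in $\mathbb{D}$ defined on another probability space $(\Omega',\mathcal{F}',P')$, such that the map $t \mapsto Y(\omega',t)$ is in $\mathbb{D}([0,1];\mathbb{D})$ for any $\omega' \in \Omega'$, and the vectors $(X(t_1),\ldots,X(t_k))$ and $(Y(t_1),\ldots,Y(t_k))$ have the same distribution in $\mathbb{D}^k$, for any $t_1,\ldots,t_k \in [0,1]$ and for any $k\geq 1$.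
   Context: $\mathbb{D}$ is the set of functions $x:[0,1]\to\mathbb{R}$ that are right-continuous and have left limits, with $\|x\|=\sup_{s\in[0,1]}|x(s)|$. $\Lambda$ is the set of strictly increasing continuous functions from $[0,1]$ onto $[0,1]$, and for $\lambda\in\Lambda$, $\|\lambda\|^0=\sup_{s<s'}\left|\log\frac{\lambda(s')-\lambda(s)}{s'-s}\right|$. The Skorohod $J_1$-topology on $\mathbb{D}$ is given by the (complete, separable) metric $d_{J_1}^0(x,y)=\inf_{\lambda\in\Lambda}\{\|\lambda\|^0\vee\|x-y\circ\lambda\|\}$. $\mathbb{D}$ carries its Borel $\sigma$-field for $J_1$ (which equals the $\sigma$-field generated by the evaluations $x\mapsto x(s)$), and random elements in $\mathbb{D}$ are measurable for it. $\mathbb{D}([0,1];\mathbb{D})$ is the set of functions $x:[0,1]\to\mathbb{D}$ that are right-continuous at every $t\in[0,1)$ and have a left limit $x(t-)\in\mathbb{D}$ at every $t\in(0,1]$, both with respect to $d_{J_1}^0$. For $x\in\mathbb{D}$ and $\delta\in(0,1)$, $w'(x,\delta)=\inf_{\{t_i\}}\max_{1\le i\le v}\ \sup_{s_1,s_2\in[t_{i-1},t_i)}|x(s_1)-x(s_2)|$, the infimum being over all sets $0=t_0<t_1<\dots<t_v=1$ with $\min_{1\le i\le v}(t_i-t_{i-1})>\delta$. *)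

(* Defs.v *)
From HB Require Import structures.
From mathcomp Require Import all_boot all_order all_algebra.
From mathcomp Require Import all_classical all_reals all_analysis.

Set Implicit Arguments.
Unset Strict Implicit.
Unset Printing Implicit Defensive.

Import Order.TTheory GRing.Theory Num.Theory.
Import numFieldNormedType.Exports.

Local Open Scope classical_set_scope.
Local Open Scope ring_scope.

Record I01 (R : realType) := MkI01 { I01_val : R ; I01P : 0 <= I01_val <= 1 }.

HB.instance Definition _ (R : realType) := [isSub for @I01_val R].
HB.instance Definition _ (R : realType) := [Choice of I01 R by <:].
HB.instance Definition _ (R : realType) := [Order of I01 R by <:].

Section I01_metric.
Context {R : realType}.

Definition I01_dist (s t : I01 R) : R := `|val s - val t|.

Lemma I01_distxx s : I01_dist s s = 0.
Proof. by rewrite /I01_dist subrr normr0. Qed.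

Lemma I01_dist_positivity s t : I01_dist s t = 0 -> s = t.
Proof. by move=> /normr0_eq0/subr0_eq/val_inj. Qed.

Lemma I01_dist_sym s t : I01_dist s t = I01_dist t s.
Proof. exact: distrC. Qed.

Lemma I01_dist_triangle s t u : I01_dist t u <= I01_dist t s + I01_dist s u.
Proof. exact: ler_distD. Qed.

HB.instance Definition _ := isMetric.Build R (I01 R)
  I01_distxx I01_dist_positivity I01_dist_sym I01_dist_triangle.

End I01_metric.

Section unit_interval.
Context {R : realType}.

Lemma dyadic_subproof n (i : 'I_(2 ^ n).+1) : 0 <= (i%:R / 2 ^+ n : R) <= 1.
Proof.
rewrite divr_ge0 ?exprn_ge0//= ler_pdivrMr ?exprn_gt0// mul1r -natrX ler_nat.
by rewrite -ltnS.
Qed.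

Definition dyadic n (i : 'I_(2 ^ n).+1) : I01 R := MkI01 (dyadic_subproof i).

Definition cadlag (T : topologicalType) (x : I01 R -> T) : Prop :=
  (forall t : I01 R, val t < 1 ->
     x s @[s --> within [set s : I01 R | t < s] (nbhs t)] --> x t) /\
  (forall t : I01 R, 0 < val t ->
     exists l : T, x s @[s --> within [set s : I01 R | s < t] (nbhs t)] --> l).

(* Suprema and infima are taken in [\bar R], so that those of unbounded sets
   keep their usual meaning. *)
Definition supnorm (x : I01 R -> R) : \bar R :=
  ereal_sup [set `|x s|%:E | s in setT].

Definition Lambda : set (I01 R -> I01 R) :=
  [set l : I01 R -> I01 R |
    [/\ {homo l : s t / s < t}, continuous l & set_surj setT setT l]].

Definition logslope (l : I01 R -> I01 R) : \bar R :=
  ereal_sup [set `|ln ((val (l s.2) - val (l s.1)) / (val s.2 - val s.1))|%:E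
            | s in [set s : I01 R * I01 R | s.1 < s.2]].

End unit_interval.

Record Dspace (R : realType) :=
  MkDspace { Dfun :> I01 R -> R ; DfunP : cadlag Dfun }.

Section skorohod.
Context {R : realType}.
Implicit Types x y z : Dspace R.

Definition dJ1 x y : \bar R :=
  ereal_inf [set maxe (logslope l) (supnorm (fun s => x s - y (l s)))
            | l in Lambda].

(* A partition 0 = t_0 < ... < t_v = 1 is a function [t : nat -> I01 R] of which
   only the values at 0, ..., v matter; v >= 1 is forced by t_0 <> t_v. *)
Definition wpartition (delta : R) (v : nat) (t : nat -> I01 R) : Prop :=
  [/\ val (t 0%N) = 0, val (t v) = 1,
      forall i, (i < v)%N -> t i < t i.+1 &
      forall i, (i < v)%N -> delta < val (t i.+1) - val (t i)].

Definition wprime x (delta : R) : \bar R :=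
  ereal_inf [set \big[maxe/-oo%E]_(i < p.1)
                   ereal_sup [set `|x s.1 - x s.2|%:E
                             | s in [set s : I01 R * I01 R |
                                      p.2 i <= s.1 < p.2 i.+1 /\
                                      p.2 i <= s.2 < p.2 i.+1]]
            | p in [set p : nat * (nat -> I01 R) | wpartition delta p.1 p.2]].

Lemma Dzero_subproof : cadlag (fun _ : I01 R => 0 : R).
Proof.
by split=> [t _|t _]; [exact: cvg_cst | exists 0; exact: cvg_cst].
Qed.

Lemma I01_neq (s t : I01 R) : s < t -> 0 < val t - val s.
Proof. by move=> st; rewrite subr_gt0. Qed.

Lemma Lambda_id : Lambda (@id (I01 R)).
Proof. by split => // t; exact: cvg_id. Qed.

Lemma Lambda_comp (l m : I01 R -> I01 R) :
  Lambda l -> Lambda m -> Lambda (m \o l).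
Proof.
move=> [l1 l2 l3] [m1 m2 m3]; split.
- by move=> s t /l1/m1.
- by move=> t; apply: continuous_comp; [exact: l2|exact: m2].
- by move=> t _; have [s _ <-] := m3 t I; have [u _ <-] := l3 s I; exists u.
Qed.

Lemma logslope_ub (l : I01 R -> I01 R) s t : s < t ->
  (`|ln ((val (l t) - val (l s)) / (val t - val s))|%:E <= logslope l)%E.
Proof. by move=> st; apply: ereal_sup_ubound; exists (s, t). Qed.

Lemma supnorm_ub (x : I01 R -> R) s : (`|x s|%:E <= supnorm x)%E.
Proof. by apply: ereal_sup_ubound; exists s. Qed.

Lemma logslope_id : (logslope (@id (I01 R)) <= 0)%E.
Proof.
apply: ge_ereal_sup => _ [[s t] /= st <-].
by rewrite divff ?ln1 ?normr0// gt_eqF// I01_neq.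
Qed.

Lemma logslope_comp (l m : I01 R -> I01 R) : {homo l : s t / s < t} ->
  {homo m : s t / s < t} -> (logslope (m \o l) <= logslope l + logslope m)%E.
Proof.
move=> hl hm; apply: ge_ereal_sup => _ [[s t] /= st <-].
have ls := hl _ _ st; have ms := hm _ _ ls.
apply: le_trans (leeD (logslope_ub l st) (logslope_ub m ls)).
rewrite -EFinD lee_fin; apply: le_trans (ler_normD _ _).
rewrite -lnM ?posrE ?divr_gt0 ?I01_neq//.
by rewrite [X in _ <= `|ln X|]mulrC mulrA divfK// gt_eqF// I01_neq.
Qed.

Lemma Lambda_inv (l : I01 R -> I01 R) (e : R) : Lambda l ->
  (logslope l < e%:E)%E ->
  exists m, [/\ cancel m l, Lambda m & (logslope m <= logslope l)%E].
Proof.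
move=> [hl _ sl] le.
have /choice[m mK] : forall t, exists s, l s = t.
  by move=> t; have [s _ <-] := sl t I; exists s.
have il : injective l.
  by move=> s t lst; case: (ltgtP s t) => // /hl; rewrite lst ltxx.
have lK : cancel l m by move=> t; apply: il; rewrite mK.
have hm : {homo m : s t / s < t}.
  move=> s t st; case: (ltgtP (m s) (m t)) => // [/hl|/(congr1 l)].
    by rewrite !mK => /(lt_trans st); rewrite ltxx.
  by rewrite !mK => ste; rewrite ste ltxx in st.
have lip s t : s < t -> val (m t) - val (m s) <= expR e * (val t - val s).
  move=> st; have mst := hm _ _ st.
  have := le_lt_trans (logslope_ub l mst) le; rewrite lte_fin !mK.
  rewrite ltr_norml => /andP[+ _].
  rewrite -[X in X < _]expRK ltr_ln ?posrE ?expR_gt0 ?divr_gt0 ?I01_neq//.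
  rewrite expRN ltr_pdivlMr ?I01_neq// ltr_pdivrMl ?expR_gt0//.
  exact: ltW.
exists m; split => //.
- split => //; last by move=> t _; exists (l t) => //; rewrite lK.
  move=> t; apply/(@cvg_ballP _ _ _ (nbhs t)) => eps eps0.
  have d0 : 0 < eps / expR e by rewrite divr_gt0 ?expR_gt0.
  apply/nbhs_ballP; exists (eps / expR e) => //= s.
  rewrite !ballEmdist /mdist /= /I01_dist => ts.
  have tse : expR e * `|val t - val s| < eps.
    by rewrite mulrC -ltr_pdivlMr ?expR_gt0.
  apply: le_lt_trans tse.
  case: (ltgtP s t) => [st|st|->]; last by rewrite !subrr normr0 mulr0.
  + by rewrite !gtr0_norm ?I01_neq ?lip// hm.
  + rewrite distrC [X in _ <= _ * X]distrC.
    by rewrite !gtr0_norm ?I01_neq ?lip// hm.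
- apply: ge_ereal_sup => _ [[s t] /= st <-].
  apply: le_trans (logslope_ub l (hm _ _ st)); rewrite !mK lee_fin.
  rewrite -invf_div lnV ?normrN// posrE divr_gt0 ?I01_neq//; exact: hm.
Qed.

Definition J1ball x (e : R) : set (Dspace R) := [set y | (dJ1 x y < e%:E)%E].

Lemma J1ballP x e y : J1ball x e y <-> exists l, [/\ Lambda l,
  (logslope l < e%:E)%E & (supnorm (fun s => x s - y (l s))%R < e%:E)%E].
Proof.
split=> [/ereal_inf_lt[_ [l Ll <-]]|[l [Ll l1 l2]]].
  by rewrite gt_max => /andP[? ?]; exists l.
apply: le_lt_trans (_ : maxe (logslope l)
  (supnorm (fun s => x s - y (l s))%R) < _)%E; last by rewrite gt_max l1.
by apply: ereal_inf_lbound; exists l.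
Qed.

Lemma J1ball_center x (e : R) : 0 < e -> J1ball x e x.
Proof.
move=> e0; apply/J1ballP; exists id; split; first exact: Lambda_id.
  by apply: le_lt_trans logslope_id _; rewrite lte_fin.
apply: le_lt_trans (_ : 0%:E < _)%E; last by rewrite lte_fin.
by apply: ge_ereal_sup => _ [s _ <-]; rewrite subrr normr0.
Qed.

Lemma J1ball_sym x y (e : R) : J1ball x e y -> J1ball y e x.
Proof.
move=> /J1ballP[l [Ll l1 l2]]; have [m [lm Lm ml]] := Lambda_inv Ll l1.
apply/J1ballP; exists m; split => //; first exact: le_lt_trans ml l1.
apply: le_lt_trans l2; apply: ge_ereal_sup => _ [s _ <-].
have := supnorm_ub (fun s => x s - y (l s)) (m s).
by rewrite lm distrC.
Qed.

Lemma J1ball_triangle x y z (e1 e2 : R) :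
  J1ball x e1 y -> J1ball y e2 z -> J1ball x (e1 + e2) z.
Proof.
move=> /J1ballP[l [Ll l1 l2]] /J1ballP[m [Lm m1 m2]].
apply/J1ballP; exists (m \o l); split; first exact: Lambda_comp.
  have [hl _ _] := Ll; have [hm _ _] := Lm.
  by apply: le_lt_trans (logslope_comp hl hm) _; rewrite EFinD lteD.
rewrite EFinD; apply: le_lt_trans (lteD l2 m2).
apply: ge_ereal_sup => _ [s _ <-].
apply: le_trans (leeD (supnorm_ub _ s) (supnorm_ub _ (l s))).
rewrite -EFinD lee_fin /=; apply: le_trans (ler_normD _ _).
by rewrite addrA subrK.
Qed.

HB.instance Definition _ := gen_eqMixin (Dspace R).
HB.instance Definition _ := gen_choiceMixin (Dspace R).
HB.instance Definition _ := isPointed.Build (Dspace R) (MkDspace Dzero_subproof).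
HB.instance Definition _ := hasNbhs.Build (Dspace R) (nbhs_ (entourage_ J1ball)).
HB.instance Definition _ := @Nbhs_isPseudoMetric.Build R (Dspace R)
  (entourage_ J1ball) erefl J1ball
  J1ball_center J1ball_sym J1ball_triangle erefl.
HB.instance Definition _ := Measurable.copy (Dspace R)
  (g_sigma_algebraType (@open (Dspace R))).

End skorohod.

(* Main.v *)
From HB Require Import structures.
Require Import Defs.
From mathcomp Require Import all_boot all_order all_algebra.
From mathcomp Require Import all_classical all_reals all_analysis.
From mathcomp Require Import measurable_realfun lra zify.

(** The proof constructs a modification [Y] of [X] on the original probability
    space: a process with càdlàg paths such that, for every [t], [Y t = X t]
    almost surely. Such a modification has the finite-dimensional distributions
    of [X].

    Control of the jumps. Condition a) says that two neighbouring increments of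
    [X], measured by the uniform distance [udist], are rarely large
    simultaneously: a path may jump, but not twice in a short time. Replacing
    [F] by [F t + t] and running [X] along the inverse of this strictly
    increasing function ([clock_exists]), one may assume that [F] is linear.
    Then, at level [k], with probability at least [1 - K * theta ^+ k], one of
    the two increments around each dyadic midpoint is smaller than [theta ^+ k]
    ([bad_level_prob]), and by the Borel-Cantelli lemma almost every path has
    this property at all fine enough levels ([ae_good_path]).

    Chaining. For such a path [f] and dyadic points [p <= q <= r] of one dyadic
    interval of level [m], one of the distances from [f q] to [f p] and to
    [f r] is at most a constant times [theta ^+ m] ([chaining]). Consequently
    [f] has one-sided limits along the dyadic points: fix [r] and look at the
    points [q] on its left. If some [f q] is far from [f r], then all [f p]
    with [p <= q] are close to [f q]; otherwise all [f q] are close to [f r].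
    Both cases give the Cauchy property for the uniform distance
    ([good_path_right], [good_path_left]). Since the space of càdlàg functions
    is complete for that distance ([udist_complete]), which dominates the J1
    distance, the right limits exist and form a càdlàg path
    ([right_lim_cadlag]).

    Identification of the limit. Along dyadic points decreasing to [t], [X]
    tends almost surely to its right limit and, by condition c), in probability
    to [X t]; hence both agree almost surely ([ae_right_lim_eq]).

    Measurability. All the events above have to be shown to be measurable for
    the Borel sigma-algebra of the J1 topology. Evaluations are Borel
    ([measurable_eval]), hence so are uniform distances ([measurable_supnorm]);
    the J1 distance of two random elements is measurable because the space is
    separable ([J1_separable], [measurable_dJ1_lt]); pointwise limits of random
    elements are random elements ([measurable_J1_lim]). *)

Set Implicit Arguments.
Unset Strict Implicit.
Unset Printing Implicit Defensive.

Import Order.TTheory GRing.Theory Num.Theory.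
Import numFieldNormedType.Exports.

Local Open Scope classical_set_scope.
Local Open Scope ring_scope.

(** * The unit interval *)

Section unit_interval.
Context {R : realType}.
Implicit Types (s t u : I01 R) (r : R).

Lemma ltI01 s t : (s < t) = (val s < val t).
Proof. by []. Qed.

Lemma leI01 s t : (s <= t) = (val s <= val t).
Proof. by []. Qed.

Lemma I01_ge0 t : 0 <= val t.
Proof. by case: t => r /= /andP[]. Qed.

Lemma I01_le1 t : val t <= 1.
Proof. by case: t => r /= /andP[]. Qed.

Lemma clip_subproof r : 0 <= Num.min 1 (Num.max 0 r) <= 1.
Proof. by rewrite le_min ler01 le_max lexx ge_min lexx. Qed.

Definition clip r : I01 R := MkI01 (clip_subproof r).

Lemma clipK r : 0 <= r <= 1 -> val (clip r) = r.
Proof. by move=> /andP[r0 r1] /=; rewrite max_r// min_r. Qed.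

Lemma clip0 : val (clip 0) = 0.
Proof. by rewrite clipK// lexx ler01. Qed.

Lemma clip1 : val (clip 1) = 1.
Proof. by rewrite clipK// lexx ler01. Qed.

Lemma clip_val t : clip (val t) = t.
Proof. by apply: val_inj; rewrite clipK// I01_ge0 I01_le1. Qed.

Lemma clip_lip r r' : `|val (clip r) - val (clip r')| <= `|r - r'|.
Proof.
have vE q : [\/ val (clip q) = 0 /\ q <= 0, [/\ val (clip q) = q, 0 <= q & q <= 1] |
             val (clip q) = 1 /\ 1 <= q].
  case: (lerP q 0) => [q0|q0].
    by constructor 1; rewrite /= max_l// min_r// ler01.
  case: (lerP q 1) => [q1|q1].
    by constructor 2; rewrite clipK ?(ltW q0).
  by constructor 3; rewrite /= max_r ?min_l ?ltW.
have := vE r; have := vE r'; move: (val (clip r)) (val (clip r')) => a b hb ha.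
rewrite ler_norml; case: (ger0P (r - r')) => ?; apply/andP; split;
  by case: ha => [[]|[]|[]] *; case: hb => [[]|[]|[]] *; lra.
Qed.

Lemma I01_ballE t (e : R) s : ball t e s = (`|val s - val t| < e) :> Prop.
Proof. by rewrite ballEmdist /= /mdist /= /I01_dist distrC. Qed.

Lemma I01_nbhsP t (A : set (I01 R)) :
  nbhs t A <-> exists2 e : R, 0 < e & forall s, `|val s - val t| < e -> A s.
Proof.
split=> [/nbhs_ballP[e /= e0 eA]|[e e0 eA]].
  by exists e => // s st; apply: eA; rewrite I01_ballE.
by apply/nbhs_ballP; exists e => //= s st; apply: eA; rewrite -I01_ballE.
Qed.

Lemma clip_continuous : continuous clip.
Proof.
move=> r; apply/cvg_ballP => e e0; rewrite near_simpl.
apply/nbhs_ballP; exists e => //= r'; rewrite /ball /= => rr'; rewrite /I01_dist.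
exact: le_lt_trans (clip_lip _ _) rr'.
Qed.

Lemma I01_IVT (h : I01 R -> R) (v : R) : continuous h ->
  h (clip 0) <= v <= h (clip 1) -> exists u, h u = v.
Proof.
move=> hc /andP[h0 h1].
have [||c _ hcv] := @IVT R (h \o clip) 0 1 v ler01.
- apply: continuous_subspaceT => r; apply: continuous_comp; last exact: hc.
  exact: clip_continuous.
- by rewrite ge_min h0 le_max h1 orbT.
- by exists (clip c).
Qed.

Lemma small_natinv (e : R) : 0 < e -> exists n : nat, n.+1%:R^-1 < e.
Proof.
move=> e0; have [N _ NP] := near_infty_natSinv_lt (PosNum e0).
by exists N; apply: (NP N) => /=.
Qed.

Lemma I01_right t (dl : R) : val t < 1 -> 0 < dl ->
  exists2 u, t < u & val u < val t + dl.
Proof.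
move=> t1 dl0; pose q := Num.min 1 (val t + dl / 2).
have tq : val t < q by rewrite lt_min t1 ltrDl divr_gt0.
have qE : val (clip q) = q.
  by rewrite clipK// (le_trans (I01_ge0 t) (ltW tq)) ge_min lexx.
exists (clip q); rewrite ?ltI01 qE//.
by rewrite gt_min ltrD2l ltr_pdivrMr// ltr_pMr// ltr1n orbT.
Qed.

End unit_interval.

(** * Càdlàg functions *)

Section cadlag_moduli.
Context {R : realType}.
Implicit Types (s t u : I01 R).

Lemma cadlag_right_modulus (x : I01 R -> R) t (e : R) : cadlag x ->
  val t < 1 -> 0 < e ->
  exists2 dl : R, 0 < dl & forall s, t < s -> val s < val t + dl -> `|x s - x t| < e.
Proof.
move=> [xr _] t1 e0; have /cvgr_dist_lt/(_ _ e0) := xr t t1.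
rewrite near_withinE => /I01_nbhsP[dl dl0 dlP]; exists dl => // s ts st.
rewrite distrC; apply: (dlP s) => //.
by rewrite ger0_norm ?subr_ge0; [lra|exact: ltW].
Qed.

Lemma cadlag_left_modulus (x : I01 R -> R) t (e : R) : cadlag x ->
  0 < val t -> 0 < e ->
  exists2 dl : R, 0 < dl & forall s s', s < t -> val t - dl < val s ->
    s' < t -> val t - dl < val s' -> `|x s - x s'| < e.
Proof.
move=> [_ xl] t0 e0; have [l] := xl t t0.
have e20 : 0 < e / 2 by rewrite divr_gt0.
move=> /cvgr_dist_lt/(_ _ e20); rewrite near_withinE => /I01_nbhsP[dl dl0 dlP].
have H s : s < t -> val t - dl < val s -> `|l - x s| < e / 2.
  move=> ts st; apply: (dlP s) => //.
  have : val s < val t by exact: ts.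
  by move=> ?; rewrite ltr0_norm; lra.
exists dl => // s s' ? ? ? ?; rewrite [e]splitr (le_lt_trans (ler_distD l _ _))//.
by rewrite ltrD// ?H// distrC H.
Qed.

(** Left limits come from the completeness of [dist], which may induce a finer
    topology than that of [T]. *)
Lemma cadlag_of_moduli (T : topologicalType) (dist : T -> T -> R)
  (dist_sym : forall x y, dist x y = dist y x)
  (dist_tri : forall x y z, dist x z <= dist x y + dist y z)
  (dist_complete : forall u : nat -> T,
     (forall e : R, 0 < e -> exists N : nat, forall n m,
        (N <= n)%N -> (N <= m)%N -> dist (u n) (u m) < e) ->
     exists l, forall e : R, 0 < e -> exists N : nat, forall n,
        (N <= n)%N -> dist (u n) l < e)
  (dist_nbhs : forall x (A : set T), nbhs x A ->
     exists2 e : R, 0 < e & forall y, dist x y < e -> A y)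
  (x : I01 R -> T) :
  (forall t, val t < 1 -> forall e : R, 0 < e ->
     exists2 dl : R, 0 < dl & forall s, t < s -> val s < val t + dl ->
       dist (x s) (x t) < e) ->
  (forall t, 0 < val t -> forall e : R, 0 < e ->
     exists2 dl : R, 0 < dl & forall s s', s < t -> val t - dl < val s ->
       s' < t -> val t - dl < val s' -> dist (x s) (x s') < e) ->
  cadlag x.
Proof.
move=> xr xl; split=> [t t1 A /dist_nbhs[e e0 eA]|t t0].
  rewrite /fmap/= /within/=; have [dl dl0 dlP] := xr t t1 e e0.
  apply/I01_nbhsP; exists dl => // s st ts; apply: eA; rewrite dist_sym.
  by apply: dlP => //; move: st; rewrite ltr_norml => /andP[]; lra.
have [q q1 q0] : exists2 q : nat -> R, (forall n, 0 < q n <= val t) &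
    forall dl : R, 0 < dl -> exists N, forall n, (N <= n)%N -> q n < dl.
  exists (fun n => val t / n.+1%:R) => [n|dl dl0].
    rewrite divr_gt0 ?ltr0n//= ler_pdivrMr ?ltr0n//.
    by rewrite ler_peMr ?(ltW t0)// ler1n.
  have [N Ndl] := @small_natinv R (dl / val t) (divr_gt0 dl0 t0).
  exists N => n Nn; rewrite mulrC -ltr_pdivlMr//; apply: le_lt_trans Ndl.
  by rewrite lef_pV2 ?posrE ?ltr0n// ler_nat ltnS.
pose u n := clip (val t - q n).
have uv n : val (u n) = val t - q n.
  have /andP[? ?] := q1 n; have := I01_le1 t => ?.
  by apply: clipK; apply/andP; split; lra.
have ut n : u n < t.
  by have /andP[? _] := q1 n; rewrite ltI01 uv; lra.
have ucl (dl : R) : 0 < dl -> exists N, forall n, (N <= n)%N -> val t - dl < val (u n).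
  by move=> /q0[N NP]; exists N => n /NP; rewrite uv; lra.
have [l lP] : exists l, forall e : R, 0 < e -> exists N : nat, forall n,
    (N <= n)%N -> dist (x (u n)) l < e.
  apply: (dist_complete (x \o u)) => e e0; have [dl dl0 dlP] := xl t t0 e e0.
  have [N NP] := ucl _ dl0; exists N => n m Nn Nm.
  by apply: dlP => //; exact: NP.
exists l => A /dist_nbhs[e e0 eA].
have e20 : 0 < e / 2 by rewrite divr_gt0.
have [dl dl0 dlP] := xl t t0 _ e20.
have [N NP] := ucl _ dl0; have [M MP] := lP _ e20.
rewrite /fmap/= /within/=; apply/I01_nbhsP; exists dl => // s st ts; apply: eA.
pose n := maxn N M; have st' : val s < val t by exact: ts.
rewrite (le_lt_trans (dist_tri _ (x (u n)) _))// [e]splitr ltrD//.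
  by rewrite dist_sym; apply: MP; rewrite leq_maxr.
apply: dlP => //; first by apply: NP; rewrite leq_maxl.
by move: st; rewrite ltr_norml => /andP[]; lra.
Qed.

Lemma real_cauchy_seq (u : nat -> R) :
  (forall e : R, 0 < e -> exists N : nat, forall n m,
     (N <= n)%N -> (N <= m)%N -> `|u n - u m| < e) ->
  exists l, forall e : R, 0 < e -> exists N : nat, forall n,
     (N <= n)%N -> `|u n - l| < e.
Proof.
move=> uc; have : cvg (u n @[n --> \oo]).
  apply/cauchy_cvgP/cauchy_exP => e e0; have [N NP] := uc e e0.
  exists (u N); exists N => // n /= Nn; rewrite /ball /=; exact: NP.
move=> /cvg_ex[l /cvgr_dist_lt ul]; exists l => e e0.
by have [N _ NP] := ul e e0; exists N => n Nn; rewrite distrC; exact: NP.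
Qed.

Lemma cadlag_of_real_moduli (x : I01 R -> R) :
  (forall t, val t < 1 -> forall e : R, 0 < e ->
     exists2 dl : R, 0 < dl & forall s, t < s -> val s < val t + dl ->
       `|x s - x t| < e) ->
  (forall t, 0 < val t -> forall e : R, 0 < e ->
     exists2 dl : R, 0 < dl & forall s s', s < t -> val t - dl < val s ->
       s' < t -> val t - dl < val s' -> `|x s - x s'| < e) ->
  cadlag x.
Proof.
apply: (@cadlag_of_moduli R (fun a b => `|a - b|)).
- by move=> a b; rewrite distrC.
- by move=> a b c; exact: ler_distD.
- exact: real_cauchy_seq.
- by move=> a A /nbhs_ballP[e e0 eA]; exists e.
Qed.

End cadlag_moduli.

Section partitions.
Context {R : realType}.
Implicit Types (s t u c : I01 R) (L : seq (I01 R)).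

(** A list of cut points splits the interval into cells [c, c'); counting the
    cut points to the left of a point labels its cell without having to sort
    the list. *)
Definition cell L s : nat := count (fun c => c <= s) L.

Lemma cell_mono L s s' : s <= s' -> (cell L s <= cell L s')%N.
Proof. by move=> ss'; apply: sub_count => c /= /le_trans; apply. Qed.

(** The sets of cut points to the left of two points are nested, so that they
    are equal as soon as they have as many elements. *)
Lemma cell_eq L s s' : cell L s = cell L s' ->
  forall c, c \in L -> (c <= s) = (c <= s').
Proof.
wlog ss' : s s' / s <= s' => [H ce c cL|].
  by case: (leP s s') => [|/ltW] ss'; [|symmetry]; apply: H.
elim: L => [//|a L IH] ce c; have := cell_mono L ss'; move: ce; rewrite /cell /=.
have : (a <= s) ==> (a <= s') by apply/implyP => /le_trans; apply.
rewrite in_cons; have := IH; rewrite /cell => {}IH h1 h2 h3.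
have h : (a <= s) = (a <= s').
  by move: h1 h2 h3; case: (a <= s); case: (a <= s') => //=; lia.
by move: h2; rewrite h => /addnI/IH{}IH /orP[/eqP->//|/IH].
Qed.

Lemma cadlag_partition (x : I01 R -> R) (e : R) : cadlag x -> 0 < e ->
  exists L, forall s s', cell L s = cell L s' -> `|x s - x s'| < e.
Proof.
move=> cx e0; have e20 : 0 < e / 2 by rewrite divr_gt0.
(* The supremum of the points up to which a partition exists is attained and
   cannot be smaller than 1. *)
pose A := [set b : R | 0 <= b <= 1 /\ exists L, forall s s',
  val s <= b -> val s' <= b -> cell L s = cell L s' -> `|x s - x s'| < e].
have A0 : A 0.
  split; first by rewrite lexx ler01.
  exists [::] => s s' s0 s'0 _.
  have /val_inj -> : val s = val s' by have := I01_ge0 s; have := I01_ge0 s'; lra.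
  by rewrite subrr normr0.
have supA : has_sup A by split; [exists 0 | exists 1 => b [/andP[]]].
have c01 : 0 <= sup A <= 1.
  apply/andP; split; first exact: sup_upper_bound.
  by apply: ge_sup; [exists 0|move=> b [/andP[]]].
set c := clip (sup A); have cE : val c = sup A by rewrite clipK.
have [L LP] : exists L, forall s s',
    s <= c -> s' <= c -> cell L s = cell L s' -> `|x s - x s'| < e.
  case: (ltrP 0 (val c)) => [c0|c0]; last first.
    exists [::] => s s' sc s'c _.
    have -> : s = s'.
      apply: val_inj; have := I01_ge0 s; have := I01_ge0 s'.
      by have : val s <= val c := sc; have : val s' <= val c := s'c; lra.
    by rewrite subrr normr0.
  have [dl dl0 dlP] := cadlag_left_modulus cx c0 e0.
  have [b [/andP[b0 b1] [L LP]] bc] := sup_adherent dl0 supA.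
  exists [:: clip b, c & L] => s s' sc s'c ce.
  have /= eb := cell_eq ce (mem_head _ _).
  have ec : (c <= s) = (c <= s') by apply: (cell_eq ce); rewrite !inE eqxx orbT.
  have bE : val (clip b) = b by rewrite clipK // b0 b1.
  have cL : cell L s = cell L s' by move: ce; rewrite /cell /= eb ec => /addnI/addnI.
  case: (leP c s) ec => [cs|cs] /esym ec.
    have -> : s = c by apply/le_anti; rewrite sc.
    have -> : s' = c by apply/le_anti; rewrite s'c.
    by rewrite subrr normr0.
  have {}ec : s' < c by rewrite ltNge ec.
  case: (leP (clip b) s) eb => [bs|bs] /esym eb.
    have hs : b <= val s by rewrite -bE.
    have hs' : b <= val s' by rewrite -bE.
    by apply: dlP => //; rewrite cE; lra.
  have hs : val s < b by rewrite -bE.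
  have hs' : val s' < b by rewrite -bE; rewrite leNgt in eb; move/negbFE: eb.
  by apply: LP => //; exact: ltW.
case: (ltrP (val c) 1) => [c1|c1]; last first.
  exists L => s s'; apply: LP; apply: le_trans c1; exact: I01_le1.
have [dl dl0 dlP] := cadlag_right_modulus cx c1 e20.
pose b := Num.min 1 (val c + dl / 2).
have cb : val c < b by rewrite /b lt_min c1 ltrDl divr_gt0.
have bdl : b < val c + dl.
  by rewrite /b gt_min; apply/orP; right; rewrite ltrD2l ltr_pdivrMr// ltr_pMr// ltr1n.
suff : A b by move=> /(sup_upper_bound supA); rewrite leNgt -cE cb.
split; first by rewrite /b ge_min lexx le_min ler01 addr_ge0 ?I01_ge0//= divr_ge0// ltW.
exists (c :: L) => s s' sb s'b ce.
have ec := cell_eq ce (mem_head _ _).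
have cL : cell L s = cell L s' by move: ce; rewrite /cell /= ec => /addnI.
case: (leP c s) ec => [cs|cs] /esym ec.
  have H u : c <= u -> val u <= b -> `|x u - x c| < e / 2.
    rewrite le_eqVlt => /orP[/eqP <- _|cu ub]; first by rewrite subrr normr0.
    by apply: dlP => //; apply: le_lt_trans bdl.
  rewrite [e]splitr (le_lt_trans (ler_distD (x c) _ _))// ltrD ?H//.
  by rewrite distrC H.
apply: LP => //; first exact: ltW.
by rewrite leNgt; apply/negP => /ltW; rewrite ec.
Qed.

Definition cell_rep L k : I01 R := xget (clip 0) [set s | cell L s = k].

Lemma cell_repK L s : cell L (cell_rep L (cell L s)) = cell L s.
Proof. exact: (@xgetPex _ (clip 0) [set t | cell L t = cell L s] (ex_intro _ s erefl)). Qed.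

Lemma cell_size L s : (cell L s < (size L).+1)%N.
Proof. by rewrite ltnS count_size. Qed.

(** There are finitely many cells, and the oscillation on each is at most 1. *)
Lemma cadlag_bounded (x : I01 R -> R) : cadlag x -> exists M, forall s, `|x s| <= M.
Proof.
move=> /cadlag_partition/(_ ltr01)[L LP].
exists (1 + \sum_(k < (size L).+1) `|x (cell_rep L k)|) => s.
have := LP s (cell_rep L (cell L s)); rewrite cell_repK => /(_ erefl) /ltW h.
rewrite -[x s](subrK (x (cell_rep L (cell L s)))) (le_trans (ler_normD _ _))//.
apply: lerD h _; rewrite (bigD1 (Ordinal (cell_size L s)))//= lerDl.
exact: sumr_ge0.
Qed.

End partitions.

(** * The uniform distance on the space of càdlàg functions *)

Section uniform_distance.
Context {R : realType}.
Implicit Types (x y z : Dspace R) (s : I01 R).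

Definition udist x y : R := fine (supnorm (fun s => x s - y s)).

Lemma supnorm_udist x y : supnorm (fun s => x s - y s) = (udist x y)%:E.
Proof.
have [M MP] := cadlag_bounded (DfunP x); have [N NP] := cadlag_bounded (DfunP y).
rewrite fineK// fin_real//; apply/andP; split.
  by apply: lt_le_trans (supnorm_ub _ (clip 0)); exact: ltNyr.
apply: (@le_lt_trans _ _ (M + N)%:E); last exact: ltry.
apply: ge_ereal_sup => _ [s _ <-].
by rewrite lee_fin (le_trans (ler_normB _ _))// lerD.
Qed.

Lemma udist_ub x y s : `|x s - y s| <= udist x y.
Proof. by have := supnorm_ub (fun s => x s - y s) s; rewrite supnorm_udist. Qed.

Lemma udist_le x y (e : R) : (forall s, `|x s - y s| <= e) -> udist x y <= e.
Proof.
move=> H; rewrite -lee_fin -supnorm_udist; apply: ge_ereal_sup => _ [s _ <-].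
by rewrite lee_fin.
Qed.

Lemma udist_sym x y : udist x y = udist y x.
Proof.
by apply/le_anti/andP; split; apply: udist_le => s; rewrite distrC udist_ub.
Qed.

Lemma udist_tri x y z : udist x z <= udist x y + udist y z.
Proof.
apply: udist_le => s; apply: le_trans (ler_distD (y s) _ _) _.
by rewrite lerD// udist_ub.
Qed.

Lemma udistxx x : udist x x = 0.
Proof.
apply/le_anti/andP; split; first by apply: udist_le => s; rewrite subrr normr0.
by apply: le_trans (udist_ub x x (clip 0)).
Qed.

Lemma udist_ge0 x y : 0 <= udist x y.
Proof. exact: le_trans (udist_ub x y (clip 0)). Qed.

Lemma udist_J1ball x y (e : R) : udist x y < e -> J1ball x e y.
Proof.
move=> xy; apply/J1ballP; exists id; split; first exact: Lambda_id.
  apply: le_lt_trans (@logslope_id R) _; rewrite lte_fin.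
  exact: le_lt_trans (udist_ge0 x y) xy.
by rewrite supnorm_udist lte_fin.
Qed.

Lemma udist_nbhs x (A : set (Dspace R)) : nbhs x A ->
  exists2 e : R, 0 < e & forall y, udist x y < e -> A y.
Proof.
by move=> /nbhs_ballP[e e0 eA]; exists e => // y /udist_J1ball xy; exact: eA.
Qed.

(** The limit exists pointwise by completeness of the reals, and the moduli of
    a uniform limit are controlled by those of one term of the sequence. *)
Lemma udist_complete (u : nat -> Dspace R) :
  (forall e : R, 0 < e -> exists N : nat, forall n m,
     (N <= n)%N -> (N <= m)%N -> udist (u n) (u m) < e) ->
  exists l, forall e : R, 0 < e -> exists N : nat, forall n,
     (N <= n)%N -> udist (u n) l < e.
Proof.
move=> uc.
have /choice[l lP] s : exists l : R, forall e : R, 0 < e -> exists N : nat, forall n,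
    (N <= n)%N -> `|u n s - l| < e.
  apply: (@real_cauchy_seq R (fun n => u n s)) => e /uc[N NP]; exists N => n m Nn Nm.
  exact: le_lt_trans (udist_ub _ _ s) (NP _ _ Nn Nm).
have ul e : 0 < e -> exists N : nat, forall n, (N <= n)%N -> forall s, `|u n s - l s| < e.
  move=> e0; have e20 : 0 < e / 2 by rewrite divr_gt0.
  have [N NP] := uc _ e20; exists N => n Nn s; have [M MP] := lP s _ e20.
  rewrite [e]splitr (le_lt_trans (ler_distD (u (maxn N M) s) _ _))// ltrD//.
    by rewrite (le_lt_trans (udist_ub _ _ s))// NP// leq_maxl.
  by rewrite MP// leq_maxr.
have cl : cadlag l.
  apply: cadlag_of_real_moduli => t t01 e e0;
    have e30 : 0 < e / 3 by [rewrite divr_gt0]; have [N /(_ N (leqnn N)) NP] := ul _ e30.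
    have [dl dl0 dlP] := cadlag_right_modulus (DfunP (u N)) t01 e30.
    exists dl => // s ts st; have := dlP s ts st; have := NP s; have := NP t.
    by rewrite !ltr_norml => /andP[? ?] /andP[? ?] /andP[? ?]; apply/andP; split; lra.
  have [dl dl0 dlP] := cadlag_left_modulus (DfunP (u N)) t01 e30.
  exists dl => // s s' h1 h2 h3 h4; have := dlP s s' h1 h2 h3 h4.
  have := NP s; have := NP s'.
  by rewrite !ltr_norml => /andP[? ?] /andP[? ?] /andP[? ?]; apply/andP; split; lra.
exists (MkDspace cl) => e e0; have e20 : 0 < e / 2 by rewrite divr_gt0.
have [N NP] := ul _ e20; exists N => n /NP{}NP.
apply: (@le_lt_trans _ _ (e / 2)); last by rewrite ltr_pdivrMr// ltr_pMr// ltr1n.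
by apply: udist_le => s; exact/ltW/NP.
Qed.

Lemma cadlag_of_udist_moduli (x : I01 R -> Dspace R) :
  (forall t : I01 R, val t < 1 -> forall e : R, 0 < e ->
     exists2 dl : R, 0 < dl & forall s, t < s -> val s < val t + dl ->
       udist (x s) (x t) < e) ->
  (forall t : I01 R, 0 < val t -> forall e : R, 0 < e ->
     exists2 dl : R, 0 < dl & forall s s', s < t -> val t - dl < val s ->
       s' < t -> val t - dl < val s' -> udist (x s) (x s') < e) ->
  cadlag x.
Proof.
exact: (cadlag_of_moduli udist_sym udist_tri udist_complete udist_nbhs).
Qed.

End uniform_distance.

(** * Time changes *)

Section time_changes.
Context {R : realType}.
Implicit Types (s t u a c : I01 R) (L : seq (I01 R)) (l m : I01 R -> I01 R).

Lemma clip0_le t : clip 0 <= t.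
Proof. by rewrite leI01 clip0 I01_ge0. Qed.

Lemma clip1_ge t : t <= clip 1.
Proof. by rewrite leI01 clip1 I01_le1. Qed.

Lemma Lambda_le l s t : Lambda l -> (l s <= l t) = (s <= t).
Proof. by move=> [hl _ _]; exact: (le_mono hl). Qed.

Lemma Lambda0 l : Lambda l -> l (clip 0) = clip 0.
Proof.
move=> Ll; have [_ _ sl] := Ll; have [s _ ls] := sl (clip 0) I.
by apply/le_anti; rewrite clip0_le -[X in _ <= X]ls Lambda_le// clip0_le.
Qed.

Lemma Lambda1 l : Lambda l -> l (clip 1) = clip 1.
Proof.
move=> Ll; have [_ _ sl] := Ll; have [s _ ls] := sl (clip 1) I.
by apply/le_anti; rewrite clip1_ge -[X in X <= _]ls Lambda_le// clip1_ge.
Qed.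

(** Slopes are compared on the interval from the fixed point 0. *)
Lemma logslope_displacement l s (e : R) : Lambda l -> (logslope l < e%:E)%E ->
  `|val (l s) - val s| <= expR e - 1.
Proof.
move=> Ll lle; have [s0|s0] := eqVneq s (clip 0).
  rewrite s0 Lambda0// subrr normr0 subr_ge0 -expR0 ler_expR -lee_fin.
  apply: le_trans (ltW lle); have lt01 : clip 0 < clip 1 :> I01 R.
    by rewrite ltI01 clip0 clip1 ltr01.
  by have := logslope_ub l lt01; apply: le_trans; rewrite lee_fin.
have z0 : val (clip 0 : I01 R) = 0 by exact: clip0.
have lts : clip 0 < s by rewrite lt_neqAle eq_sym s0 clip0_le.
have ps : 0 < val s by move: lts; rewrite ltI01 z0.
have pls : 0 < val (l s).
  by have [hl _ _] := Ll; have := hl _ _ lts; rewrite Lambda0// ltI01 z0.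
have := le_lt_trans (logslope_ub l lts) lle.
rewrite Lambda0// z0 !subr0 lte_fin => h.
have e0 : 0 < e by apply: le_lt_trans h.
move: h; rewrite ltr_norml => /andP[h1 h2].
have {}h1 : expR (- e) * val s < val (l s).
  by rewrite -ltr_pdivlMr// -[X in _ < X]lnK ?ltr_expR// posrE divr_gt0.
have {}h2 : val (l s) < expR e * val s.
  by rewrite -ltr_pdivrMr// -[X in X < _]lnK ?ltr_expR// posrE divr_gt0.
have := I01_le1 s; have := expR_ge1Dx e; have := expR_ge1Dx (- e) => a b s1.
clear lle.
have p1 : 0 <= e * (1 - val s) by rewrite mulr_ge0 ?subr_ge0// ltW.
have p2 : 0 <= (expR e - 1) * (1 - val s) by rewrite mulr_ge0; lra.
have p3 : 0 <= (expR (- e) - (1 - e)) * val s by rewrite mulr_ge0; lra.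
by rewrite ler_norml; apply/andP; split; nra.
Qed.

(** A perturbation of the identity with small Lipschitz constant is a time
    change, because it stays increasing; its slopes are close to 1. *)
Lemma Lambda_lipschitz (phi : I01 R -> R) (k e : R) :
  (forall s t, `|phi s - phi t| <= k * `|val s - val t|) ->
  phi (clip 0) = 0 -> phi (clip 1) = 0 -> expR (- e) <= 1 - k ->
  let l s := clip (val s + phi s) in
  [/\ forall s, val (l s) = val s + phi s, Lambda l & (logslope l <= e%:E)%E].
Proof.
move=> lip p0 p1 ke l.
have k1 : k < 1 by have := expR_gt0 (- e); lra.
have z0 : val (clip 0 : I01 R) = 0 by exact: clip0.
have z1 : val (clip 1 : I01 R) = 1 by exact: clip1.
have incr s t : s <= t ->
    (1 - k) * (val t - val s) <= val t + phi t - (val s + phi s) <= (1 + k) * (val t - val s).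
  move=> st; have := lip t s; have : val s <= val t by exact: st.
  rewrite -subr_ge0 => h; rewrite (ger0_norm h) ler_norml => /andP[? ?].
  by apply/andP; split; lra.
have lE s : val (l s) = val s + phi s.
  apply: clipK; have := incr _ _ (clip0_le s); have := incr _ _ (clip1_ge s).
  rewrite p0 p1 z0 z1; have := I01_ge0 s; have := I01_le1 s => ? ? /andP[? ?] /andP[? ?].
  by apply/andP; split; nra.
have hl : {homo l : s t / s < t}.
  move=> s t st; have /andP[h _] := incr _ _ (ltW st).
  rewrite ltI01 !lE -subr_gt0.
  by apply: lt_le_trans h; rewrite mulr_gt0 ?subr_gt0.
have cl : continuous (fun s => val s + phi s).
  move=> t; apply/(@cvgrPdist_lt _ _ _ (nbhs t)) => eps eps0; rewrite near_simpl.
  apply/I01_nbhsP; exists (eps / 2); first by rewrite divr_gt0.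
  move=> s st.
  have -> : val t + phi t - (val s + phi s) = (val t - val s) + (phi t - phi s) by lra.
  apply: le_lt_trans (ler_normD _ _) _.
  have h1 : `|val t - val s| < eps / 2 by rewrite distrC.
  have h2 : k * `|val t - val s| <= `|val t - val s| by rewrite ler_piMl// ltW.
  by have := lip t s; lra.
split=> //; first split=> //.
- move=> t; have -> : l = clip \o (fun s => val s + phi s) by [].
  by apply: continuous_comp; [exact: cl|exact: clip_continuous].
- move=> t _; have [|s ls] := I01_IVT (v := val t) cl.
    by rewrite p0 p1 z0 z1 !addr0 I01_ge0 I01_le1.
  by exists s => //; apply: val_inj; rewrite lE.
apply: ge_ereal_sup => _ [[s t] /= st <-]; rewrite lee_fin.
change (`|ln ((val (l t) - val (l s)) / (val t - val s))| <= e).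
have ps := I01_neq st; have := incr _ _ (ltW st); rewrite !lE => /andP[h1 h2].
have pl : 0 < val t + phi t - (val s + phi s) by apply: lt_le_trans h1; rewrite mulr_gt0 ?subr_gt0.
rewrite ler_norml; apply/andP; split.
  rewrite -[X in X <= _]expRK ler_ln ?posrE ?expR_gt0 ?divr_gt0//.
  by rewrite ler_pdivlMr//; apply: le_trans h1; rewrite ler_pM2r.
rewrite -[X in _ <= X]expRK ler_ln ?posrE ?expR_gt0 ?divr_gt0//.
rewrite ler_pdivrMr//; apply: le_trans h2 _; rewrite ler_pM2r//.
by have := expR_ge1Dx e; have := expR_ge1Dx (- e); lra.
Qed.

Lemma tent_lipschitz (h dl : R) a s t : 0 < dl ->
  `|h * Num.max 0 (1 - `|val s - val a| / dl)
    - h * Num.max 0 (1 - `|val t - val a| / dl)|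
  <= `|h| / dl * `|val s - val t|.
Proof.
move=> dl0; rewrite -mulrBr normrM -mulrA ler_wpM2l//.
have max_lip (p q : R) : `|Num.max 0 p - Num.max 0 q| <= `|p - q|.
  by rewrite !maxEle; case: ifPn => ?; case: ifPn => ?;
    rewrite ler_norml; case: (ger0P (p - q)) => ?; apply/andP; split; lra.
apply: le_trans (max_lip _ _) _.
set A := `|val s - val a|; set B := `|val t - val a|.
have -> : 1 - A / dl - (1 - B / dl) = (B - A) / dl by rewrite mulrBl; lra.
rewrite normrM [X in _ * X]ger0_norm ?invr_ge0 ?(ltW dl0)// mulrC ler_pM2l ?invr_gt0//.
apply: le_trans (ler_dist_dist _ _) _; rewrite distrC.
by have -> : val s - val a - (val t - val a) = val s - val t by lra.
Qed.

(** * Separability *)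

(** Indices beyond [2 ^ k.1] are clipped to the point 1. *)
Definition dy (k : nat * nat) : I01 R := clip (k.2%:R / 2 ^+ k.1).

Lemma dy_dense a (e : R) : 0 < e -> exists k, `|val (dy k) - val a| < e.
Proof.
move=> e0; have [n ne] := small_natinv e0.
exists (n, Num.trunc (2 ^+ n * val a)).
set k := Num.trunc _; have := clip_lip (k%:R / 2 ^+ n) (val a).
rewrite clip_val => h; apply: (le_lt_trans h); rewrite {h}/k.
have ha : 0 <= 2 ^+ n * val a by rewrite mulr_ge0 ?exprn_ge0 ?I01_ge0.
have /andP[h1 h2] := trunc_itv ha.
have n0 : (0 : R) < 2 ^+ n by rewrite exprn_gt0.
apply: le_lt_trans ne; rewrite distrC ger0_norm; last first.
  by rewrite subr_ge0 ler_pdivrMr// [X in _ <= X]mulrC.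
apply: (@le_trans _ _ (2 ^+ n)^-1).
  rewrite lerBlDr -(ler_pM2l n0) mulrDr mulfV ?gt_eqF//.
  by rewrite mulrCA mulfV ?gt_eqF// mulr1 addrC natr1 ltW.
rewrite lef_pV2 ?posrE// ?ltr0n// -natrX ler_nat; exact: ltn_expl.
Qed.

Lemma dy_right a (dl : R) : val a < 1 -> 0 < dl ->
  exists2 k, a < dy k & val (dy k) < val a + dl.
Proof.
move=> a1 dl0; have [u au ua] := I01_right a1 dl0.
have [|k ku] := @dy_dense u (Num.min (val u - val a) (val a + dl - val u)).
  by rewrite lt_min !subr_gt0 ua andbT.
move: ku; rewrite lt_min !ltr_norml => /andP[/andP[h1 _] /andP[_ h2]].
by exists k; rewrite ?ltI01; lra.
Qed.

Lemma separated L a : exists2 dl : R, 0 < dl &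
  forall c, c \in L -> c != a -> dl <= `|val c - val a|.
Proof.
elim: L => [|b L [dl dl0 dlP]]; first by exists 1.
have [ba|ba] := eqVneq b a.
  by exists dl => // c; rewrite inE => /orP[/eqP->|/dlP//]; rewrite ba eqxx.
exists (Num.min dl `|val b - val a|).
  by rewrite lt_min dl0 normr_gt0 subr_eq0.
move=> c; rewrite inE => /orP[/eqP-> _|/dlP H /H]; rewrite ge_min.
  by rewrite lexx orbT.
by move=> ->.
Qed.

(** A dyadic point very close to [a] is moved to [a] by a tent centred at it,
    narrow enough to vanish on [L] and flat enough to have small slopes. *)
Lemma align_point L a (e : R) : 0 < e -> a \notin L ->
  a != clip 0 -> a != clip 1 ->
  exists k m, [/\ Lambda m, (logslope m < e%:E)%E, m (dy k) = a &
    forall c, c \in L -> m c = c].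
Proof.
move=> e0 aL a0 a1; have [dl dl0 dlP] := separated [:: clip 0, clip 1 & L] a.
pose k0 : R := 1 - expR (- (e / 2)).
have k00 : 0 < k0 by rewrite subr_gt0 -expR0 ltr_expR oppr_lt0 divr_gt0.
have dl20 : 0 < dl / 2 by rewrite divr_gt0.
have [|k kP] := @dy_dense a (Num.min (dl / 2) (k0 * (dl / 2))).
  by rewrite lt_min dl20 mulr_gt0.
move: kP; rewrite lt_min => /andP[kd kk].
pose h := val a - val (dy k).
pose phi s := h * Num.max 0 (1 - `|val s - val (dy k)| / (dl / 2)).
have phi0 c : c != a -> c \in [:: clip 0, clip 1 & L] -> phi c = 0.
  move=> ca cL; rewrite /phi max_l ?mulr0// subr_le0 ler_pdivlMr// mul1r.
  have := dlP c cL ca; have := ler_distD (val (dy k)) (val c) (val a).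
  by move: kd; set A := `|val (dy k) - val a|; lra.
have [||||mE Lm lm] := @Lambda_lipschitz phi k0 (e / 2).
- move=> s t; apply: le_trans (tent_lipschitz _ _ _ _ dl20) _.
  apply: ler_wpM2r => //; rewrite ler_pdivrMr//; apply: ltW.
  by rewrite /h distrC.
- by apply: phi0; rewrite ?inE ?eqxx// eq_sym.
- by apply: phi0; rewrite ?inE ?eqxx ?orbT// eq_sym.
- by rewrite /k0; lra.
exists k, (fun s => clip (val s + phi s)); split => //.
- by apply: le_lt_trans lm _; rewrite lte_fin ltr_pdivrMr// ltr_pMr// ltr1n.
- apply: val_inj; rewrite mE /phi subrr normr0 mul0r subr0 max_r// mulr1 /h.
  by rewrite addrC subrK.
- move=> c cL; apply: val_inj; rewrite mE phi0 ?addr0//.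
    by apply: contraNneq aL => <-.
  by rewrite !inE cL !orbT.
Qed.

(** Finitely many points can be made dyadic by a time change close to the
    identity; the points are treated one after the other, each by a
    perturbation supported away from those already treated. *)
Lemma align_points L (e : R) : 0 < e -> exists K m,
  [/\ Lambda m, (logslope m < e%:E)%E & map (m \o dy) K = L].
Proof.
elim: L e => [|a L IH] e e0.
  exists [::], id; split=> //; first exact: Lambda_id.
  by apply: le_lt_trans (@logslope_id R) _; rewrite lte_fin.
have e20 : 0 < e / 2 by rewrite divr_gt0.
have [K [m [Lm lm <-]]] := IH _ e20.
have [hm _ sm] := Lm; have [b _ <-] := sm a I.
have [[k kb]|nk] := pselect (exists k, dy k = b).
  exists (k :: K), m; split=> //=; last by rewrite kb.
  by apply: lt_trans lm _; rewrite lte_fin ltr_pdivrMr// ltr_pMr// ltr1n.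
have [|||k [m' [Lm' lm' m'k m'L]]] := @align_point (map dy K) b _ e20.
- by apply/mapP => -[k _ bk]; apply: nk; exists k.
- apply/eqP => b0; apply: nk; exists (0%N, 0%N).
  by rewrite b0 /dy mul0r.
- apply/eqP => b1; apply: nk; exists (0%N, 1%N).
  by rewrite b1 /dy expr0 divr1.
exists (k :: K), (m \o m'); split=> /=.
- exact: Lambda_comp.
- have [hm' _ _] := Lm'; apply: le_lt_trans (logslope_comp hm' hm) _.
  by rewrite [e]splitr EFinD lteD.
- rewrite m'k; congr cons; apply/eq_in_map => i iK /=.
  by rewrite m'L// map_f.
Qed.

End time_changes.

Section separability.
Context {R : realType}.
Implicit Types (x y : Dspace R) (s : I01 R) (k : seq (nat * nat) * seq int).

(** The cut points [k.1] are dyadic and the values are multiples of [e], so that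
    codes range over a countable type; cells, and not sorted cut points, index
    the values. *)
Definition code_step (e : R) k s : R :=
  e * (nth 0 k.2 (cell (map dy k.1) s))%:~R.

Definition has_code (e : R) k x := exists l,
  [/\ Lambda l, (logslope l < e%:E)%E & forall s, `|x (l s) - code_step e k s| < 2 * e].

(** Align the cut points of a partition with small oscillation to dyadic points,
    and round down one value in each cell. *)
Lemma code_exists x (e : R) : 0 < e -> exists k, has_code e k x.
Proof.
move=> e0; have [L LP] := cadlag_partition (DfunP x) e0.
have [K [l [Ll le KL]]] := align_points L e0.
have cellE s : cell (map dy K) s = cell L (l s).
  rewrite -KL /cell !count_map; apply: eq_count => i /=.
  by rewrite Lambda_le.
pose D := map (@dy R) K.
exists (K, mkseq (fun j => Num.floor (x (l (cell_rep D j)) / e)) (size D).+1).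
exists l; split => // s; rewrite /code_step /= nth_mkseq ?cell_size// -/D.
set r := cell_rep D _.
have -> : x (l s) - e * (Num.floor (x (l r) / e))%:~R
    = (x (l s) - x (l r)) + (x (l r) - e * (Num.floor (x (l r) / e))%:~R) by lra.
apply: le_lt_trans (ler_normD _ _) _; rewrite mulr2n mulrDl mul1r ltrD//.
  by apply: LP; rewrite -!cellE /r cell_repK.
have /andP[h1 h2] := floor_itv (x (l r) / e).
move: h1 h2; rewrite ler_pdivlMr// ltr_pdivrMr// intrD mulrDl mul1r ![_ * e]mulrC => h1 h2.
by rewrite ger0_norm; lra.
Qed.

(** One of the two time changes is composed with the inverse of the other. *)
Lemma same_code (e : R) k x y : has_code e k x -> has_code e k y ->
  J1ball x (5 * e) y.
Proof.
move=> [l [Ll ll xl]] [l' [Ll' ll' yl]].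
have e0 : 0 < e.
  by have := le_lt_trans (normr_ge0 _) (xl (clip 0)); rewrite pmulr_rgt0.
have [m [mK Lm lm]] := Lambda_inv Ll ll.
apply/J1ballP; exists (l' \o m); split; first exact: Lambda_comp.
  have [hm _ _] := Lm; have [hl' _ _] := Ll'.
  apply: le_lt_trans (logslope_comp hm hl') _.
  apply: (@lt_trans _ _ (e + e)%:E).
    by rewrite EFinD lteD// (le_lt_trans lm).
  by rewrite lte_fin; lra.
apply: (@le_lt_trans _ _ (4 * e)%:E); last by rewrite lte_fin; lra.
apply: ge_ereal_sup => _ [s _ <-]; rewrite lee_fin /=.
have := xl (m s); have := yl (m s); rewrite mK !ltr_norml ler_norml.
by move=> /andP[? ?] /andP[? ?]; apply/andP; split; lra.
Qed.

(** Elements sharing a code are close to each other, so that picking one element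
    for each code and each precision gives a dense sequence. *)
Lemma J1_separable : exists c : nat -> Dspace R,
  forall x (e : R), 0 < e -> exists n, J1ball (c n) e x.
Proof.
pose C : Type := (nat * (seq (nat * nat) * seq int))%type.
pose c0 (k : C) : Dspace R := xget point [set x | has_code k.1.+1%:R^-1 k.2 x].
exists (fun n => if @unpickle C n is Some k then c0 k else point) => x e e0.
have [N Ne] := @small_natinv R (e / 5) (divr_gt0 e0 (ltr0n _ 5)).
have N0 : (0 : R) < N.+1%:R^-1 by rewrite invr_gt0 ltr0n.
have {}Ne : 5 * N.+1%:R^-1 < e by rewrite mulrC -ltr_pdivlMr.
have [k kx] := code_exists x N0.
exists (pickle (N, k)); rewrite pickleK.
have ck : has_code N.+1%:R^-1 k (c0 (N, k)).
  exact: (@xgetPex _ point [set x | has_code N.+1%:R^-1 k x] (ex_intro _ x kx)).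
have /J1ballP[l [Ll l1 l2]] := same_code ck kx.
apply/J1ballP; exists l; split => //; [apply: lt_trans l1 _|apply: lt_trans l2 _];
  by rewrite lte_fin.
Qed.

End separability.

(** * Measurability *)

Section measurability.
Context {R : realType}.
Implicit Types (x y : Dspace R) (s : I01 R).

Lemma dJ1_between x y (e : R) : J1ball x e y -> exists2 e' : R, e' < e & J1ball x e' y.
Proof.
rewrite /J1ball /=; case: (dJ1 x y) => [r|//|] => [|_].
  rewrite lte_fin => re; exists ((r + e) / 2); last rewrite /= lte_fin; lra.
by exists (e - 1); [lra | rewrite /= ltNyr].
Qed.

Lemma J1_openP (A : set (Dspace R)) :
  (forall x, A x -> exists2 e : R, 0 < e & J1ball x e `<=` A) -> open A.
Proof.
by move=> H; rewrite openE => x /H[e e0 eA]; apply/nbhs_ballP; exists e.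
Qed.

Lemma J1ball_open x (e : R) : open (J1ball x e).
Proof.
apply: J1_openP => y /dJ1_between[e' ee' xy].
exists (e - e'); first by rewrite subr_gt0.
by move=> z yz; have := J1ball_triangle xy yz; rewrite addrC subrK.
Qed.

Lemma measurable_J1ball x (e : R) : measurable (J1ball x e).
Proof. by apply: sub_sigma_algebra; exact: J1ball_open. Qed.

(** The Borel sets of the square are generated by products because the space is
    separable, which makes the distance jointly measurable. *)
Lemma measurable_dJ1_lt d (T : measurableType d) (f g : T -> Dspace R) (e : R) :
  measurable_fun setT f -> measurable_fun setT g ->
  measurable [set w | (dJ1 (f w) (g w) < e%:E)%E].
Proof.
move=> mf mg; have [c cP] := @J1_separable R.
have -> : [set w | (dJ1 (f w) (g w) < e%:E)%E] = \bigcup_n \bigcup_N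
   ((f @^-1` J1ball (c n) N.+1%:R^-1) `&` (g @^-1` J1ball (c n) (e - N.+1%:R^-1))).
  apply/seteqP; split=> [w /dJ1_between[e' ee' fg]|w [n _ [N _ [/= cf cg]]]]; last first.
    have -> : e = N.+1%:R^-1 + (e - N.+1%:R^-1) by rewrite addrC subrK.
    by apply: J1ball_triangle cg; exact: J1ball_sym.
  have [N Ne] := @small_natinv R ((e - e') / 2) ltac:(by rewrite divr_gt0 ?subr_gt0).
  have [n cf] := cP (f w) N.+1%:R^-1 ltac:(by rewrite invr_gt0 ltr0n).
  exists n => //; exists N => //; split => //=.
  apply: lt_trans (J1ball_triangle cf fg) _.
  by rewrite lte_fin; move: Ne; move: (N.+1%:R^-1) => i; clear cf fg; lra.
apply: bigcupT_measurable => n; apply: bigcupT_measurable => N.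
by apply: measurableI; rewrite -[X in measurable X]setTI;
  [apply: mf|apply: mg] => //; exact: measurable_J1ball.
Qed.

(** A time change close to the identity moves [u] by little, hence keeps it
    inside the open interval. *)
Lemma J1_open_exceed (a b r : R) :
  open [set x : Dspace R | exists u : I01 R, [/\ a < val u, val u < b & r < x u]].
Proof.
apply: J1_openP => x [u [au ub xu]].
have [h h0 [ha hb]] : exists2 h : R, 0 < h & h <= val u - a /\ h <= b - val u.
  exists (Num.min (val u - a) (b - val u)); first by rewrite lt_min !subr_gt0 au.
  by rewrite !ge_min !lexx orbT.
pose e := Num.min (ln (1 + h / 2)) (x u - r).
have e0 : 0 < e by rewrite lt_min ln_gt0 ?ltrDl ?divr_gt0// subr_gt0.
exists e; [by []|move=> y /J1ballP[l [Ll le xy]]].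
exists (l u).
have hl : `|val (l u) - val u| <= h / 2.
  apply: le_trans (logslope_displacement u Ll le) _.
  have h1 : 0 < 1 + h / 2 by rewrite addr_gt0 ?divr_gt0.
  by rewrite lerBlDl -[X in _ <= X]lnK ?posrE// ler_expR ge_min lexx.
have := le_lt_trans (supnorm_ub _ u) xy; rewrite lte_fin lt_min => /andP[_].
rewrite ltr_norml /= => /andP[_ hy].
by move: hl; rewrite ler_norml => /andP[? ?]; clear le xy; split; [change (a < val (l u))|change (val (l u) < b)|]; lra.
Qed.

(** Evaluations are not J1-continuous, but the supremum over an open interval
    is lower semicontinuous, and evaluation at a point is the limit of such
    suprema by right-continuity. The right endpoint is fixed by every time
    change. *)
Lemma measurable_eval s : measurable_fun [set: Dspace R] (fun x => x s).
Proof.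
apply: (measurability _ (RGenInftyO.measurableE R)).
move=> _ [_ [r ->] <-]; rewrite setTI.
have [s1|s1] := ltP (val s) 1; last first.
  have -> : s = clip 1.
    by apply: val_inj; rewrite clip1; apply/le_anti; rewrite s1 I01_le1.
  apply: sub_sigma_algebra; apply: J1_openP => x /=; rewrite in_itv /= => xr.
  exists (r - x (clip 1)); first by rewrite subr_gt0.
  move=> y /J1ballP[l [Ll _ xy]] /=; rewrite in_itv /=.
  have := le_lt_trans (supnorm_ub _ (clip 1)) xy; rewrite lte_fin Lambda1//.
  by rewrite ltr_norml => /andP[? _]; lra.
pose U (k n : nat) := ~` [set x : Dspace R | exists u : I01 R,
  [/\ val s < val u, val u < val s + n.+1%:R^-1 & r - k.+1%:R^-1 < x u]].
have -> : (fun x : Dspace R => x s) @^-1` `]-oo, r[%classic = \bigcup_k \bigcup_n U k n.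
  apply/seteqP; split=> [x|x [k _ [n _ Ux]]] /=; rewrite in_itv /=.
    move=> xr; have [k kr] := @small_natinv R ((r - x s) / 2) ltac:(by rewrite divr_gt0 ?subr_gt0).
    have xr2 : 0 < (r - x s) / 2 by rewrite divr_gt0 ?subr_gt0.
    have [dl dl0 dlP] := cadlag_right_modulus (DfunP x) s1 xr2.
    have [n ndl] := small_natinv dl0.
    exists k => //; exists n => // -[u [su us xu]].
    have /dlP : s < u by exact: su.
    have us' : val u < val s + dl by apply: lt_trans us _; rewrite ltrD2l.
    move=> /(_ us'); rewrite ltr_norml => /andP[? ?].
    by move: (k.+1%:R^-1) kr xu => i kr xu; lra.
  rewrite ltNge; apply/negP => rx.
  have k0 : (0 : R) < k.+1%:R^-1 by rewrite invr_gt0 ltr0n.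
  have n0 : (0 : R) < n.+1%:R^-1 by rewrite invr_gt0 ltr0n.
  have [dl dl0 dlP] := cadlag_right_modulus (DfunP x) s1 k0.
  have [|u su us] := I01_right s1 (_ : 0 < Num.min dl n.+1%:R^-1).
    by rewrite lt_min dl0.
  have /andP[us1 us2] : (val u < val s + dl) && (val u < val s + n.+1%:R^-1).
    by move: us; rewrite -!ltrBlDl lt_min.
  apply: Ux; exists u; split => //; have := dlP u su us1.
  by rewrite ltr_norml => /andP[+ _]; move: (k.+1%:R^-1) rx => i; lra.
apply: bigcupT_measurable => k; apply: bigcupT_measurable => n.
by apply: measurableC; apply: sub_sigma_algebra; exact: J1_open_exceed.
Qed.

(** By right-continuity the supremum can be taken over the dyadic points and 1. *)
Lemma measurable_supnorm d (T : measurableType d) (f g : T -> Dspace R) :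
  measurable_fun setT f -> measurable_fun setT g ->
  measurable_fun setT ((fun w => supnorm (fun s => f w s - g w s)) : T -> \bar R).
Proof.
move=> mf mg; apply: (measurability _ (ErealGenOInfty.measurableE R)).
move=> _ [_ [r ->] <-]; rewrite setTI.
pose D : countType := option (nat * nat)%type.
pose q (k : D) : I01 R := if k is Some k then dy k else clip 1.
have -> : (fun w => supnorm (fun s => f w s - g w s)) @^-1` `]r%:E, +oo[%classic =
    \bigcup_(k : D) [set w | r < `|f w (q k) - g w (q k)|].
  apply/seteqP; split=> [w|w [k _ /= kr]] /=; rewrite in_itv /= andbT.
    move=> /ereal_sup_gt[_ [s _ <-]]; rewrite lte_fin => rs.
    have [s1|s1] := ltP (val s) 1; last first.
      exists None => //=; suff <- : s = clip 1 by [].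
      by apply: val_inj; rewrite clip1; apply/le_anti; rewrite s1 I01_le1.
    have e0 : 0 < (`|f w s - g w s| - r) / 2 by rewrite divr_gt0 ?subr_gt0.
    have [dl dl0 dlP] := cadlag_right_modulus (DfunP (f w)) s1 e0.
    have [dl' dl'0 dl'P] := cadlag_right_modulus (DfunP (g w)) s1 e0.
    have [|k sk ks] := dy_right s1 (_ : 0 < Num.min dl dl').
      by rewrite lt_min dl0.
    have /andP[k1 k2] : (val (dy k) < val s + dl) && (val (dy k) < val s + dl').
      by move: ks; rewrite -!ltrBlDl lt_min.
    exists (Some k) => //=; have := dlP _ sk k1; have := dl'P _ sk k2.
    have := ler_normD (f w (dy k) - g w (dy k))
      ((f w s - f w (dy k)) - (g w s - g w (dy k))).
    have := ler_normB (f w s - f w (dy k)) (g w s - g w (dy k)).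
    rewrite [f w (dy k) - g w (dy k) + _](_ : _ = f w s - g w s); last by lra.
    by rewrite [`|f w s - f w _|]distrC [`|g w s - g w _|]distrC; lra.
  by apply: lt_le_trans (supnorm_ub _ (q k)); rewrite lte_fin.
apply: countable_bigcupT_measurable => [|k]; first exact: countableP.
have mF (h : T -> Dspace R) : measurable_fun setT h -> measurable_fun setT (fun w => h w (q k)).
  by move=> mh; exact: (measurableT_comp (measurable_eval (q k)) mh).
have mN := measurableT_comp (@normr_measurable R setT) (measurable_funB (mF _ mf) (mF _ mg)).
have := mN measurableT _ (measurable_itv `]r, +oo[); rewrite setTI.
congr measurable; apply/seteqP.
by split=> w /=; rewrite in_itv /= andbT.
Qed.

(** Points at distance zero are in the same open sets, hence in the same Borel
    sets; evaluations being Borel, such points are equal. *)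
Lemma J1_separated x y : (forall e : R, 0 < e -> J1ball x e y) -> x = y.
Proof.
move=> xy; have iff_xy (A : set (Dspace R)) : measurable A -> A x <-> A y.
  apply: (@smallest_sub _ (sigma_algebra setT) open [set A : set (Dspace R) | A x <-> A y]).
    split => //=.
    - by move=> B /= Bxy; split=> -[_ nB]; split=> // /Bxy.
    - by move=> F FP; split=> -[n _ Fn]; exists n => //; apply/FP.
  move=> B oB; split=> Bz; have := oB; rewrite openE => /(_ _ Bz)/nbhs_ballP[e /= e0];
    apply; [exact: xy|exact/J1ball_sym/xy].
have fxy : Dfun x = Dfun y.
  apply/funext => s.
  have := measurable_eval s measurableT (measurable_set1 (x s)).
  by rewrite setTI => mA; have [/(_ erefl) /= ->] := iff_xy _ mA.
by case: x y fxy {xy iff_xy} => f fP [g gP] /= fg; move: gP; rewrite -fg => gP;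
  congr MkDspace; exact: Prop_irrelevance.
Qed.

(** The limit lies in an open set [U] when, for some radius, the balls of that
    radius around the approximating points are eventually included in [U]. *)
Lemma measurable_J1_lim d (T : measurableType d) (f_ : nat -> T -> Dspace R)
    (f : T -> Dspace R) :
  (forall n, measurable_fun setT (f_ n)) ->
  (forall w (e : R), 0 < e ->
     exists N : nat, forall n, (N <= n)%N -> J1ball (f w) e (f_ n w)) ->
  measurable_fun setT f.
Proof.
move=> mf_ f_f; apply: (@measurability _ _ _ _ setT f open erefl) => _ [U oU <-].
rewrite setTI.
pose F (e : R) := [set x : Dspace R | J1ball x e `<=` U].
have mF e : measurable (F e).
  rewrite -[F e]setCK; apply: measurableC; apply: sub_sigma_algebra.
  apply: J1_openP => x /existsNP[y /not_implyP[/dJ1_between[e' ee' xy] Uy]].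
  exists (e - e'); first by rewrite subr_gt0.
  move=> z xz zU; apply/Uy/zU; have := J1ball_triangle (J1ball_sym xz) xy.
  by rewrite subrK.
have -> : f @^-1` U = \bigcup_k \bigcup_N \bigcap_(n in [set n | (N <= n)%N])
    (f_ n @^-1` F k.+1%:R^-1).
  apply/seteqP; split=> [w Uw|w [k _ [N _ FN]]].
    have := oU; rewrite openE => /(_ _ Uw)/nbhs_ballP[e /= e0 eU].
    have e20 : 0 < e / 2 by rewrite divr_gt0.
    have [k ke] := small_natinv e20; have [N NP] := f_f w _ e20.
    exists k => //; exists N => // n /= /NP fn z nz; apply: eU.
    apply: lt_trans (J1ball_triangle fn nz) _.
    by rewrite lte_fin [ltRHS]splitr ltrD2l.
  have [|M MP] := f_f w k.+1%:R^-1; first by rewrite invr_gt0 ltr0n.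
  apply: (FN (maxn N M)); first exact: leq_maxl.
  by apply/J1ball_sym/MP; rewrite leq_maxr.
apply: bigcupT_measurable => k; apply: bigcupT_measurable => N.
apply: bigcap_measurable; first by exists N => /=.
by move=> n _; rewrite -[X in measurable X]setTI; exact: mf_.
Qed.

End measurability.

(** * Chaining *)

Section chaining.
Context {R : realType} {T : Type} (dist : T -> T -> R).
Context (dist_sym : forall x y, dist x y = dist y x).
Context (dist_tri : forall x y z, dist x z <= dist x y + dist y z).
Context (distxx : forall x, dist x x = 0).

(** A path with a single jump has a small [min_incr] over any two adjacent short
    intervals, so bounds on it restrict jumps without excluding them. *)
Definition min_incr (x y z : T) : R := Num.min (dist x y) (dist y z).

Lemma min_incr_perturb (x y z x' y' z' : T) (h : R) :
  dist x x' <= h -> dist y y' <= h -> dist z z' <= h ->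
  min_incr x y z <= min_incr x' y' z' + 2 * h.
Proof.
move=> hx hy hz.
have H (a b a' b' : T) : dist a a' <= h -> dist b b' <= h ->
    dist a b <= dist a' b' + 2 * h.
  move=> ha hb; have := dist_tri a a' b; have := dist_tri a' b' b.
  by rewrite (dist_sym b' b); lra.
rewrite /min_incr; case: (leP (dist x' y') (dist y' z')) => _.
  by rewrite ge_min; apply/orP; left; exact: H.
by rewrite ge_min; apply/orP; right; exact: H.
Qed.

Context (g : nat -> nat -> T) (theta : R) (m : nat).
Context (g_nested : forall k i, g k.+1 i.*2 = g k i).
Context (theta01 : 0 < theta < 1).
Context (g_mid : forall k i, (m < k)%N -> (i.*2.+1 < 2 ^ k)%N ->
  min_incr (g k i.*2) (g k i.*2.+1) (g k i.*2.+2) <= theta ^+ k).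

(** Rounding a midpoint across the smaller of its two increments costs no more
    than [min_incr] there. *)
Definition round_to_level k a : nat :=
  if odd a && (dist (g k.+1 a) (g k.+1 a.+1) < dist (g k.+1 a.-1) (g k.+1 a))
  then a./2.+1 else a./2.

Lemma round_to_level_bounds k a :
  (a./2 <= round_to_level k a <= uphalf a)%N.
Proof. by rewrite /round_to_level; case: ifP => [/andP[]|]; lia. Qed.

Lemma round_to_level_mono k a b : (a <= b)%N ->
  (round_to_level k a <= round_to_level k b)%N.
Proof.
rewrite leq_eqVlt => /orP[/eqP->//|ab].
have := round_to_level_bounds k a; have := round_to_level_bounds k b; lia.
Qed.

Lemma round_to_level_dist k a : (m <= k)%N -> (a <= 2 ^ k.+1)%N ->
  dist (g k.+1 a) (g k (round_to_level k a)) <= theta ^+ k.+1.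
Proof.
have /andP[t0 t1] := theta01.
move=> mk ak; have [oa|ea] := boolP (odd a); last first.
  rewrite /round_to_level (negbTE ea) /= -(g_nested k) even_halfK// distxx.
  by rewrite exprn_ge0// ltW.
have aE : a = a./2.*2.+1 by lia.
have ak' : (a./2.*2.+1 < 2 ^ k.+1)%N.
  by rewrite -aE; move: ak oa; rewrite expnS; lia.
have := g_mid (mk : (m < k.+1)%N) ak'.
rewrite /min_incr -aE /round_to_level oa /= [in a.-1]aE /=.
case: (ltP (dist (g k.+1 a) (g k.+1 a.+1)) _) => [lt|ge].
  by rewrite -(g_nested k) doubleS -aE.
by rewrite -(g_nested k) dist_sym.
Qed.

(** Rounding all three points to the previous level costs [2 * theta ^+ k]; the
    total cost is a geometric series, and at level [m] one of the two intervals
    is degenerate. *)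
Lemma chaining n j a b c : (j < 2 ^ m)%N ->
  (j * 2 ^ n <= a)%N -> (a <= b)%N -> (b <= c)%N -> (c <= j.+1 * 2 ^ n)%N ->
  min_incr (g (m + n) a) (g (m + n) b) (g (m + n) c)
    <= 2 / (1 - theta) * theta ^+ m.
Proof.
have /andP[t0 t1] := theta01; have t10 : 0 < 1 - theta by lra.
move=> jm ja ab bc cj.
pose K := 2 * theta / (1 - theta).
suff H : min_incr (g (m + n) a) (g (m + n) b) (g (m + n) c)
    <= K * (theta ^+ m - theta ^+ (m + n)).
  apply: (le_trans H); rewrite /K mulrBr.
  have K0 : 0 <= 2 / (1 - theta) by rewrite divr_ge0// ltW.
  have h1 : 0 <= theta ^+ m by rewrite exprn_ge0// ltW.
  have h2 : 0 <= theta ^+ (m + n) by rewrite exprn_ge0// ltW.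
  have p1 : 0 <= 2 / (1 - theta) * (1 - theta) * theta ^+ m.
    by rewrite !mulr_ge0// ?(ltW t10)// invr_ge0 ltW.
  have p2 : 0 <= 2 / (1 - theta) * theta * theta ^+ (m + n).
    by rewrite !mulr_ge0// ?(ltW t0)// invr_ge0 ltW.
  by rewrite mulrAC; lra.
elim: n a b c ja ab bc cj => [|n IH] a b c ja ab bc cj.
  rewrite addn0 subrr mulr0 /min_incr ge_min.
  have : (a == b) || (b == c) by lia.
  by case/orP => /eqP ->; rewrite distxx lexx ?orbT.
pose r := round_to_level (m + n).
have bnd x : (j * 2 ^ n.+1 <= x)%N -> (x <= j.+1 * 2 ^ n.+1)%N ->
    [/\ (j * 2 ^ n <= r x)%N, (r x <= j.+1 * 2 ^ n)%N & (x <= 2 ^ (m + n).+1)%N].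
  move=> jx xj; have := round_to_level_bounds (m + n) x; rewrite -/r.
  have : (j.+1 * 2 ^ n.+1 <= 2 ^ m * 2 ^ n.+1)%N by rewrite leq_mul2r jm orbT.
  rewrite -expnD addnS; move: jx xj; rewrite expnS !mulnA ![(_ * 2)%N]mulnC -!mulnA.
  by move=> *; split; lia.
have [ja1 ja2 ja3] := bnd a ja (leq_trans ab (leq_trans bc cj)).
have [jb1 jb2 jb3] := bnd b (leq_trans ja ab) (leq_trans bc cj).
have [jc1 jc2 jc3] := bnd c (leq_trans (leq_trans ja ab) bc) cj.
have := IH (r a) (r b) (r c) ja1 (round_to_level_mono _ ab)
  (round_to_level_mono _ bc) jc2.
rewrite addnS => {}IH.
apply: le_trans (min_incr_perturb (round_to_level_dist (leq_addr n m) ja3)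
  (round_to_level_dist (leq_addr n m) jb3)
  (round_to_level_dist (leq_addr n m) jc3)) _.
apply: le_trans (lerD IH (lexx _)) _.
rewrite exprS; set u := theta ^+ (m + n); set v := theta ^+ m.
rewrite -subr_ge0.
suff -> : K * (v - theta * u) - (K * (v - u) + 2 * (theta * u)) = 0 by [].
have -> : K * (v - theta * u) - (K * (v - u) + 2 * (theta * u))
  = K * (1 - theta) * u - 2 * theta * u by lra.
by rewrite /K divfK ?gt_eqF// subrr.
Qed.

End chaining.

(** * Dyadic points *)

Section dyadic_points.
Context {R : realType}.
Implicit Types (t : I01 R) (p q : nat * nat).

Lemma val_dy n i : (i <= 2 ^ n)%N -> val (dy (n, i) : I01 R) = i%:R / 2 ^+ n.
Proof.
move=> hi; apply: clipK => /=; rewrite divr_ge0 ?ler0n ?exprn_ge0//=.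
by rewrite ler_pdivrMr ?exprn_gt0// mul1r -natrX ler_nat.
Qed.

Lemma dy_double n i : dy (n.+1, i.*2) = dy (n, i) :> I01 R.
Proof.
rewrite /dy /=; congr clip; rewrite -muln2 natrM exprSr -mulf_div.
by rewrite divff ?mulr1// pnatr_eq0.
Qed.

Lemma dy_shift n k i : dy ((n + k)%N, (i * 2 ^ k)%N) = dy (n, i) :> I01 R.
Proof.
elim: k => [|k IH]; first by rewrite addn0 muln1.
by rewrite addnS expnS mulnCA mul2n dy_double.
Qed.

Lemma dy_clip n i : (2 ^ n <= i)%N -> dy (n, i) = clip 1 :> I01 R.
Proof.
move=> ni; apply: val_inj; rewrite /dy clip1 /= max_r ?divr_ge0 ?exprn_ge0//.
by rewrite min_l// ler_pdivlMr ?exprn_gt0// mul1r -natrX ler_nat.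
Qed.

Lemma dy_level p n : (p.1 <= n)%N -> exists2 i, (i <= 2 ^ n)%N & dy p = dy (n, i) :> I01 R.
Proof.
case: p => k i /= kn; case: (leqP i (2 ^ k)) => [ik|/ltnW ik].
  exists (i * 2 ^ (n - k))%N; last by rewrite -(dy_shift k (n - k)) subnKC.
  by apply: leq_trans (leq_mul ik (leqnn _)) _; rewrite -expnD subnKC.
by exists (2 ^ n)%N => //; rewrite !dy_clip.
Qed.

Lemma dy_le n i j : (i <= 2 ^ n)%N -> (j <= 2 ^ n)%N ->
  (dy (n, i) <= dy (n, j) :> I01 R) = (i <= j)%N.
Proof.
by move=> ni nj; rewrite leI01 !val_dy// ler_pM2r ?invr_gt0 ?exprn_gt0// ler_nat.
Qed.

(** Lies strictly to the right of [t], even for dyadic [t], except at [t = 1]. *)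
Definition dy_after n t : I01 R := dy (n, (Num.trunc (2 ^+ n * val t)).+1).

Let scaled_ge0 n t : 0 <= 2 ^+ n * val t.
Proof. by rewrite mulr_ge0 ?exprn_ge0 ?I01_ge0. Qed.

Lemma trunc_lt n t : val t < 1 -> (Num.trunc (2 ^+ n * val t) < 2 ^ n)%N.
Proof.
move=> t1; rewrite -(ltr_nat R) natrX.
have /andP[h _] := trunc_itv (scaled_ge0 n t).
by apply: le_lt_trans h _; rewrite gtr_pMr ?exprn_gt0.
Qed.

Lemma dy_after_gt n t : val t < 1 -> t < dy_after n t.
Proof.
move=> t1; rewrite ltI01 val_dy ?trunc_lt// ltr_pdivlMr ?exprn_gt0// mulrC.
by have /andP[] := trunc_itv (scaled_ge0 n t).
Qed.

Lemma dy_after1 n t : ~~ (val t < 1) -> dy_after n t = t.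
Proof.
rewrite -leNgt => t1; have tE : val t = 1 by apply/le_anti; rewrite I01_le1.
rewrite /dy_after dy_clip; first by apply: val_inj; rewrite clip1.
rewrite tE mulr1 -(ler_nat R) natrX.
by have /andP[_ /ltW] := trunc_itv (exprn_ge0 n (ler0n R 2)).
Qed.

Lemma dy_after_ge n t : t <= dy_after n t.
Proof.
have [t1|t1] := boolP (val t < 1); first exact/ltW/dy_after_gt.
by rewrite dy_after1.
Qed.

Lemma dy_after_le n t : val (dy_after n t) <= val t + (2 ^+ n)^-1.
Proof.
have [t1|t1] := boolP (val t < 1); last by rewrite dy_after1// lerDl invr_ge0 exprn_ge0.
rewrite val_dy ?trunc_lt// ler_pdivrMr ?exprn_gt0// mulrDl mulVf ?expf_neq0//.
rewrite -natr1 lerD2r [val t * _]mulrC.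
by have /andP[] := trunc_itv (scaled_ge0 n t).
Qed.

Lemma dy_after_near t (e : R) : 0 < e ->
  exists N, forall n, (N <= n)%N -> val (dy_after n t) < val t + e.
Proof.
move=> e0; have [N Ne] := small_natinv e0; exists N => n Nn.
apply: le_lt_trans (dy_after_le n t) _; rewrite ltrD2l; apply: le_lt_trans Ne.
rewrite lef_pV2 ?posrE ?exprn_gt0 ?ltr0n// -natrX ler_nat.
exact: leq_ltn_trans Nn (ltn_expl _ _).
Qed.

Lemma dy_after_nonincreasing n t : dy_after n.+1 t <= dy_after n t.
Proof.
have [t1|t1] := boolP (val t < 1); last by rewrite !dy_after1.
rewrite /dy_after -(dy_double n) dy_le ?trunc_lt//; last first.
  by rewrite expnS mul2n leq_double trunc_lt.
rewrite -(ltr_nat R).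
have /andP[h _] := trunc_itv (scaled_ge0 n.+1 t); apply: le_lt_trans h _.
have /andP[_ h] := trunc_itv (scaled_ge0 n t).
by rewrite exprS -mulrA -mul2n natrM ltr_pM2l.
Qed.

Lemma dy_before_exists m t : 0 < val t -> exists2 j, (j < 2 ^ m)%N &
  dy (m, j) < t /\ t <= dy (m, j.+1).
Proof.
move=> t0; have h0 := scaled_ge0 m t.
have /andP[h1 h2] := trunc_itv h0; set j := Num.trunc _ in h1 h2.
have m0 : (0 : R) < 2 ^+ m by rewrite exprn_gt0.
have jm : (j <= 2 ^ m)%N.
  rewrite -(ler_nat R) natrX (le_trans h1)// ler_piMr ?I01_le1// ltW.
have [je|jn] := eqVneq (j%:R : R) (2 ^+ m * val t).
  have j0 : (0 < j)%N by rewrite -(ltr_nat R) je mulr_gt0.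
  have jm' : (j.-1 < 2 ^ m)%N by rewrite prednK.
  exists j.-1 => //; rewrite prednK// ltI01 leI01 !val_dy// ?(ltnW jm')//.
  rewrite ltr_pdivrMr// ler_pdivlMr// [val t * _]mulrC -je lexx; split => //.
  by rewrite ltr_nat prednK.
have {}h1 : j%:R < 2 ^+ m * val t by rewrite lt_neqAle jn.
have jm' : (j < 2 ^ m)%N.
  by rewrite -(ltr_nat R) natrX (lt_le_trans h1)// ler_piMr ?I01_le1// ltW.
exists j => //; rewrite ltI01 leI01 !val_dy//.
by rewrite ltr_pdivrMr// ler_pdivlMr// [val t * _]mulrC; split=> //; exact: ltW.
Qed.

End dyadic_points.

(** * One-sided limits along dyadic points *)

Section good_paths.
Context {R : realType} {T : Type} (dist : T -> T -> R).
Context (dist_sym : forall x y, dist x y = dist y x).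
Context (dist_tri : forall x y z, dist x z <= dist x y + dist y z).
Context (distxx : forall x, dist x x = 0).
Context (theta : R).
Context (theta01 : 0 < theta < 1).
Implicit Types (f : I01 R -> T) (t : I01 R).

(** Only midpoints are constrained, because chaining passes from each level to
    the previous one. *)
Definition good_path f := exists M : nat, forall k, (M <= k)%N ->
  forall i, (i.*2.+1 < 2 ^ k)%N ->
  min_incr dist (f (dy (k, i.*2))) (f (dy (k, i.*2.+1))) (f (dy (k, i.*2.+2)))
    < theta ^+ k.

(** Three dyadic points have a common level, at which chaining applies. *)
Lemma good_path_window f (e : R) : good_path f -> 0 < e ->
  exists m, forall j, (j < 2 ^ m)%N -> forall p q r,
    dy (m, j) <= dy p :> I01 R -> dy p <= dy q :> I01 R ->
    dy q <= dy r :> I01 R -> dy r <= dy (m, j.+1) :> I01 R ->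
    min_incr dist (f (dy p)) (f (dy q)) (f (dy r)) < e.
Proof.
move=> [M MP] e0; have /andP[t0 t1] := theta01.
have [m Mm me] : exists2 m, (M <= m)%N & 2 / (1 - theta) * theta ^+ m < e.
  have K0 : 0 < 2 / (1 - theta) by rewrite divr_gt0// subr_gt0.
  have : `|theta| < 1 by rewrite gtr0_norm.
  move=> /cvg_expr/cvgr_dist_lt/(_ _ (divr_gt0 e0 K0))[N _ NP].
  exists (maxn M N); first exact: leq_maxl.
  have := NP _ (leq_maxr M N); rewrite sub0r normrN ger0_norm ?exprn_ge0 ?(ltW t0)//.
  by rewrite ltr_pdivlMr// mulrC.
exists m => j jm p q r; pose k := (p.1 + q.1 + r.1)%N.
have [a an ->] := @dy_level R p (m + k) ltac:(rewrite /k; lia).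
have [b bn ->] := @dy_level R q (m + k) ltac:(rewrite /k; lia).
have [c cn ->] := @dy_level R r (m + k) ltac:(rewrite /k; lia).
have jk : (j.+1 * 2 ^ k <= 2 ^ (m + k))%N by rewrite expnD leq_mul2r jm orbT.
have jk' : (j * 2 ^ k <= 2 ^ (m + k))%N.
  by rewrite (leq_trans _ jk)// leq_mul2r leqnSn orbT.
rewrite -(dy_shift m k j) -(dy_shift m k j.+1).
rewrite !dy_le// => ja ab bc cj.
apply: le_lt_trans me.
apply: (chaining (g := fun k i => f (dy (k, i))) dist_sym dist_tri distxx _ theta01 _
  jm ja ab bc cj).
- by move=> l i; rewrite dy_double.
- by move=> l i ml il; apply/ltW/MP => //; rewrite (leq_trans Mm)// ltnW.
Qed.

(** In a dyadic interval with right end [c], if some [f b] is far from [f c],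
    then all values at dyadic points between [t] and [b] are close to [f b];
    otherwise all values are close to [f c]. *)
Lemma good_path_right f t (e : R) : good_path f -> val t < 1 -> 0 < e ->
  exists2 dl : R, 0 < dl & forall p q,
    t < dy p -> val (dy p) < val t + dl -> t < dy q -> val (dy q) < val t + dl ->
    dist (f (dy p)) (f (dy q)) < e.
Proof.
move=> gf t1 e0; have e20 : 0 < e / 2 by rewrite divr_gt0.
have [m mP] := good_path_window gf e20.
pose j := Num.trunc (2 ^+ m * val t).
have jm : (j < 2 ^ m)%N by exact: trunc_lt.
have jt : dy (m, j) <= t.
  rewrite leI01 val_dy ?(ltnW jm)// ler_pdivrMr ?exprn_gt0// mulrC.
  by have /andP[] := @trunc_itv R (2 ^+ m * val t) ltac:(by rewrite mulr_ge0 ?exprn_ge0 ?I01_ge0).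
have tc : t < dy (m, j.+1) by exact: dy_after_gt.
have [[b [tb bc fb]]|nb] := pselect (exists b, [/\ t < dy b, dy b <= dy (m, j.+1) :> I01 R &
    e / 2 <= dist (f (dy b)) (f (dy (m, j.+1)))]).
  have H p : t < dy p -> val (dy p) < val t + (val (dy b) - val t) ->
      dist (f (dy p)) (f (dy b)) < e / 2.
    rewrite addrC subrK => tp /ltW pb.
    have := mP j jm p b (m, j.+1) (le_trans jt (ltW tp)) pb bc (lexx _).
    by rewrite /min_incr gt_min => /orP[//|]; rewrite ltNge fb.
  exists (val (dy b) - val t); first by rewrite subr_gt0.
  move=> p q tp pb tq qb; apply: le_lt_trans (dist_tri _ (f (dy b)) _) _.
  by rewrite [e]splitr ltrD ?H// dist_sym H.
have H p : t < dy p -> val (dy p) < val t + (val (dy (m, j.+1)) - val t) ->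
    dist (f (dy p)) (f (dy (m, j.+1))) < e / 2.
  rewrite addrC subrK => tp /ltW pb; rewrite ltNge; apply/negP => h.
  by apply: nb; exists p.
exists (val (dy (m, j.+1)) - val t); first by rewrite subr_gt0.
move=> p q tp pb tq qb; apply: le_lt_trans (dist_tri _ (f (dy (m, j.+1))) _) _.
by rewrite [e]splitr ltrD ?H// dist_sym H.
Qed.

(** The mirror image of the previous argument, with the left end of a dyadic
    interval in the role of [c]. *)
Lemma good_path_left f t (e : R) : good_path f -> 0 < val t -> 0 < e ->
  exists2 dl : R, 0 < dl & forall p q,
    dy p < t -> val t - dl < val (dy p) -> dy q < t -> val t - dl < val (dy q) ->
    dist (f (dy p)) (f (dy q)) < e.
Proof.
move=> gf t0 e0; have e20 : 0 < e / 2 by rewrite divr_gt0.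
have [m mP] := good_path_window gf e20.
have [j jm [ct tj]] := dy_before_exists m t0.
have [[b [bt cb fb]]|nb] := pselect (exists b, [/\ dy b < t, dy (m, j) <= dy b :> I01 R &
    e / 2 <= dist (f (dy (m, j))) (f (dy b))]).
  have H p : dy p < t -> val t - (val t - val (dy b)) < val (dy p) ->
      dist (f (dy p)) (f (dy b)) < e / 2.
    rewrite opprB addrC subrK => pt /ltW bp.
    have := mP j jm (m, j) b p (lexx _) cb bp (le_trans (ltW pt) tj).
    by rewrite /min_incr gt_min => /orP[|]; [rewrite ltNge fb|rewrite dist_sym].
  exists (val t - val (dy b)); first by rewrite subr_gt0.
  move=> p q tp pb tq qb; apply: le_lt_trans (dist_tri _ (f (dy b)) _) _.
  by rewrite [e]splitr ltrD ?H// dist_sym H.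
have H p : dy p < t -> val t - (val t - val (dy (m, j))) < val (dy p) ->
    dist (f (dy p)) (f (dy (m, j))) < e / 2.
  rewrite opprB addrC subrK => pt /ltW bp; rewrite dist_sym ltNge; apply/negP => h.
  by apply: nb; exists p.
exists (val t - val (dy (m, j))); first by rewrite subr_gt0.
move=> p q tp pb tq qb; apply: le_lt_trans (dist_tri _ (f (dy (m, j))) _) _.
by rewrite [e]splitr ltrD ?H// dist_sym H.
Qed.

End good_paths.

(** * Regularisation of paths *)

Section regularisation.
Context {R : realType}.
Context (theta : R).
Context (theta01 : 0 < theta < 1).
Implicit Types (f : I01 R -> Dspace R) (t : I01 R).

(** The limit is taken for the uniform distance; the default value is reached
    only by paths which are not good. *)
Definition right_lim f t : Dspace R := xget point [set l | forall e : R, 0 < e ->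
  exists N : nat, forall n, (N <= n)%N -> udist (f (dy_after n t)) l < e].

Lemma right_limP f t : good_path (@udist R) theta f -> forall e : R, 0 < e ->
  exists N : nat, forall n, (N <= n)%N -> udist (f (dy_after n t)) (right_lim f t) < e.
Proof.
move=> gf; apply: (@xgetPex _ point [set l | forall e : R, 0 < e ->
  exists N : nat, forall n, (N <= n)%N -> udist (f (dy_after n t)) l < e]).
apply: udist_complete => e e0; have [t1|t1] := boolP (val t < 1); last first.
  by exists 0%N => n m _ _; rewrite !dy_after1// udistxx.
have [dl dl0 dlP] := good_path_right udist_sym udist_tri udistxx theta01 gf t1 e0.
have [N NP] := dy_after_near t dl0.
by exists N => n m Nn Nm; apply: dlP; rewrite ?dy_after_gt ?NP.
Qed.

(** The moduli of [f] along dyadic points pass to the limit. *)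
Lemma right_lim_cadlag f : good_path (@udist R) theta f -> cadlag (right_lim f).
Proof.
move=> gf.
have gfR := good_path_right udist_sym udist_tri udistxx theta01 gf.
have gfL := good_path_left udist_sym udist_tri udistxx theta01 gf.
(* Values of the limit are within e of the values of f at a dyadic point as
   close to the argument as wanted. *)
have approx (s : I01 R) (e h : R) : 0 < e -> 0 < h -> exists n,
    udist (f (dy_after n s)) (right_lim f s) < e /\ val (dy_after n s) < val s + h.
  move=> e0 h0; have [N NP] := right_limP s gf e0.
  have [M MP] := dy_after_near s h0; exists (maxn N M).
  by rewrite NP ?leq_maxl// MP// leq_maxr.
have close (s s' : I01 R) (n n' : nat) (e : R) :
    udist (f (dy_after n s)) (right_lim f s) < e / 3 ->
    udist (f (dy_after n' s')) (right_lim f s') < e / 3 ->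
    udist (f (dy_after n s)) (f (dy_after n' s')) < e / 3 ->
    udist (right_lim f s) (right_lim f s') < e.
  rewrite (udist_sym _ (right_lim f s)) => h1 h2 h3.
  have := udist_tri (right_lim f s) (f (dy_after n s)) (right_lim f s').
  have := udist_tri (f (dy_after n s)) (f (dy_after n' s')) (right_lim f s').
  by lra.
apply: cadlag_of_udist_moduli => t t01 e e0; have e30 : 0 < e / 3 by rewrite divr_gt0.
  have [dl dl0 dlP] := gfR t _ t01 e30; exists dl => // s ts st.
  have h0 : 0 < val t + dl - val s by rewrite subr_gt0.
  have [n [n1 n2]] := approx s _ _ e30 h0.
  have [n' [n1' n2']] := approx t _ _ e30 dl0.
  apply: (close _ _ _ _ _ n1 n1'); apply: dlP => //; last exact: dy_after_gt.
    exact: lt_le_trans ts (dy_after_ge _ _).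
  by move: n2; rewrite addrC subrK.
have [dl dl0 dlP] := gfL t _ t01 e30; exists dl => // s s' st ts st' ts'.
have h0 : 0 < val t - val s by rewrite subr_gt0.
have h0' : 0 < val t - val s' by rewrite subr_gt0.
have [n [n1 n2]] := approx s _ _ e30 h0.
have [n' [n1' n2']] := approx s' _ _ e30 h0'.
apply: (close _ _ _ _ _ n1 n1'); apply: dlP.
- by move: n2; rewrite addrC subrK.
- exact: lt_le_trans ts (dy_after_ge _ _).
- by move: n2'; rewrite addrC subrK.
- exact: lt_le_trans ts' (dy_after_ge _ _).
Qed.

End regularisation.

(** * Construction of the modification *)

Section modification.
Context {R : realType} {d : measure_display} {Omega : measurableType d}.
Context (P : probability Omega R).
Implicit Types (X : I01 R -> {RV P >-> Dspace R}) (t : I01 R).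

Definition two_jumps X (lambda : R) t1 t t2 : set Omega :=
  [set w | (lambda%:E <= mine (supnorm (fun s => X t w s - X t1 w s)%R)
                              (supnorm (fun s => X t2 w s - X t w s)%R))%E].

Lemma two_jumpsE X lambda t1 t t2 w : two_jumps X lambda t1 t t2 w =
  (lambda <= min_incr (@udist R) (X t1 w) (X t w) (X t2 w)) :> Prop.
Proof.
rewrite /two_jumps /= !supnorm_udist /min_incr -EFin_min lee_fin.
by rewrite (udist_sym (X t w)) (udist_sym (X t2 w)).
Qed.

Lemma measurable_two_jumps X lambda t1 t t2 : measurable (two_jumps X lambda t1 t t2).
Proof.
have m u v : measurable [set w | (lambda%:E <= supnorm (fun s => X u w s - X v w s)%R)%E].
  have mX := measurable_supnorm (@measurable_funPT _ _ _ _ (X u)) (@measurable_funPT _ _ _ _ (X v)).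
  have := mX measurableT _ (emeasurable_itv `[lambda%:E, +oo[); rewrite setTI.
  by congr measurable; apply/seteqP; split=> w /=; rewrite in_itv /= andbT.
rewrite (_ : two_jumps _ _ _ _ _ =
  [set w | (lambda%:E <= supnorm (fun s => X t w s - X t1 w s)%R)%E] `&`
  [set w | (lambda%:E <= supnorm (fun s => X t2 w s - X t w s)%R)%E]).
  exact: measurableI.
by apply/seteqP; split=> w /=; rewrite /two_jumps /= le_min => /andP.
Qed.

Definition bad_level X (theta : R) (k : nat) : set Omega :=
  \bigcup_(i in [set i | (i.*2.+1 < 2 ^ k)%N])
    two_jumps X (theta ^+ k) (dy (k, i.*2)) (dy (k, i.*2.+1)) (dy (k, i.*2.+2)).

Lemma measurable_bad_level X theta k : measurable (bad_level X theta k).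
Proof. by apply: bigcup_measurable => i _; exact: measurable_two_jumps. Qed.

(** The exponent of [theta] is chosen so that the threshold [theta ^+ k]
    decreases slowly enough for the bound on the probability, summed over the
    [2 ^ k] dyadic points of level [k], to be geometric with the same ratio. *)
Definition chain_ratio (alpha beta : R) : R :=
  2 `^ (- ((2 * alpha - 1) / (4 * beta + 1))).

Lemma chain_ratio01 alpha beta : 2^-1 < alpha -> 0 <= beta ->
  0 < chain_ratio alpha beta < 1.
Proof.
move=> a1 b0; rewrite powR_gt0//= /chain_ratio /powR pnatr_eq0 /=.
rewrite expR_lt1 mulNr oppr_lt0 mulr_gt0 ?ln_gt0 ?ltr1n// divr_gt0//; last by lra.
by lra.
Qed.

(** Union bound over the midpoints of level [k]. *)
Lemma bad_level_prob X (alpha beta C : R) : 2^-1 < alpha -> 0 <= beta -> 0 <= C ->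
  (forall t1 t t2 lambda, t1 <= t -> t <= t2 -> 0 < lambda ->
     (P (two_jumps X lambda t1 t t2) <= ((lambda `^ (4 * beta))^-1
        * (C * (val t2 - val t1)) `^ (2 * alpha))%:E)%E) ->
  forall k, (P (bad_level X (chain_ratio alpha beta) k)
     <= ((2 * C) `^ (2 * alpha) * chain_ratio alpha beta ^+ k)%:E)%E.
Proof.
move=> a1 b0 C0 XP k; have /andP[r0 _] := chain_ratio01 a1 b0.
set r := chain_ratio alpha beta in r0 *.
pose N := (2 ^ k)./2; pose b := (2 * C) `^ (2 * alpha).
have NE i : (i.*2.+1 < 2 ^ k)%N = (i < N)%N by rewrite /N; lia.
pose J i := two_jumps X (r ^+ k) (dy (k, i.*2)) (dy (k, i.*2.+1)) (dy (k, i.*2.+2)).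
have -> : bad_level X r k = \big[setU/set0]_(i < N) J i.
  rewrite -(bigcup_mkord N J) /bad_level; apply: eq_bigcupl.
  by split=> i /=; rewrite NE.
apply: le_trans (Boole_inequality _ _) _; first by move=> i _; exact: measurable_two_jumps.
have step (i : 'I_N) : (P (J i) <= (b * r ^+ k / 2 ^+ k)%:E)%E.
  have ik : (i.*2.+2 <= 2 ^ k)%N by rewrite NE.
  apply: le_trans (XP _ _ _ _ _ _ _) _.
  - by rewrite dy_le// ltnW// ltnW.
  - by rewrite dy_le// ltnW.
  - by rewrite exprn_gt0.
  rewrite lee_fin !val_dy ?(ltnW ik) ?(ltnW (ltnW ik))//.
  have -> : C * (i.*2.+2%:R / 2 ^+ k - i.*2%:R / 2 ^+ k) = 2 * C * 2 `^ (- k%:R).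
    rewrite powR_invn// -mulrBl -addn2 natrD [_ + 2%:R]addrC addrK.
    by rewrite mulrCA mulrA.
  rewrite powRM ?mulr_ge0 ?powR_ge0// -/b mulrCA -mulrA ler_wpM2l ?powR_ge0//.
  rewrite -powRrM -!powR_mulrn ?(ltW r0) ?powR_ge0// /r /chain_ratio -!powRrM.
  rewrite -!powRN -!powRD ?pnatr_eq0 ?implybT//.
  apply: ler_powR; first by rewrite ler1n.
  (* All factors are now powers of 2; the exponents add up to that of
     [theta ^+ k] because of the equation satisfied by g. *)
  set g := (2 * alpha - 1) / (4 * beta + 1).
  have gE : g * (4 * beta + 1) = 2 * alpha - 1 by rewrite divfK// gt_eqF//; lra.
  by nra.
apply: (@le_trans _ _ (\sum_(i < N) (b * r ^+ k / 2 ^+ k)%:E)%E).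
  by apply: lee_sum => i _; exact: step.
rewrite sumEFin lee_fin sumr_const card_ord -[X in X <= _]mulr_natr -[X in X <= _]mulrA.
rewrite ler_piMr ?mulr_ge0 ?powR_ge0 ?exprn_ge0 ?(ltW r0)//.
rewrite mulrC ler_pdivrMr ?exprn_gt0// mul1r -natrX ler_nat /N; lia.
Qed.

(** Borel-Cantelli lemma for the bad levels. *)
Lemma ae_good_path X (theta K : R) : 0 < theta < 1 -> 0 <= K ->
  (forall k, (P (bad_level X theta k) <= (K * theta ^+ k)%:E)%E) ->
  P.-negligible [set w | ~ good_path (@udist R) theta (fun t => X t w)].
Proof.
move=> /andP[t0 t1] K0 PK.
exists (lim_sup_set (bad_level X theta)); split.
- apply: bigcapT_measurable => n; apply: bigcup_measurable => k _.
  exact: measurable_bad_level.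
- apply: lim_sup_set_cvg0; first exact: measurable_bad_level.
  apply: (@le_lt_trans _ _ (K / (1 - theta))%:E); last exact: ltry.
  apply: lime_le; first by apply: is_cvg_nneseries => n _ _; exact: measure_ge0.
  apply: nearW => n; apply: (@le_trans _ _ (\sum_(0 <= k < n) (K * theta ^+ k)%:E)%E).
    by apply: lee_sum => k _; exact: PK.
  rewrite sumEFin lee_fin.
  have := @geometric_seriesE R K theta; rewrite lt_eqF// => /(_ isT).
  move=> /(congr1 (fun u => u n)); rewrite /series /geometric /= => ->.
  rewrite ler_pM2r ?invr_gt0 ?subr_gt0// ler_piMr// lerBlDr lerDl.
  by rewrite exprn_ge0// ltW.
- move=> w ngood n _; apply: contrapT => nbad; apply: ngood.
  exists n => k nk i ik; rewrite ltNge; apply/negP => h; apply: nbad.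
  by exists k => //; exists i => //; rewrite two_jumpsE.
Qed.

(** If the right limit differs from [X t], then [X] stays away from [X t] at all
    late enough points of the sequence decreasing to [t]; by convergence in
    probability, each such tail event is null. *)
Lemma ae_right_lim_eq X theta t : 0 < theta < 1 ->
  (val t < 1 -> forall eps : R, 0 < eps ->
     P [set w | (eps%:E <= dJ1 (X (dy_after n t) w) (X t w))%E] @[n --> \oo] --> 0%E) ->
  P.-negligible [set w | good_path (@udist R) theta (fun t => X t w) /\
                         right_lim (fun t => X t w) t <> X t w].
Proof.
move=> t01 XP; have [t1|t1] := boolP (val t < 1); last first.
  apply: negligibleS (negligible_set0 P) => w [gw]; apply.
  apply: J1_separated => e e0; apply/J1ball_sym/udist_J1ball.
  have [N NP] := right_limP t01 t gw e0.
  by have := NP _ (leqnn N); rewrite dy_after1.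
pose D (j n : nat) := [set w | (j.+1%:R^-1%:E <= dJ1 (X (dy_after n t) w) (X t w))%E].
have mD j n : measurable (D j n).
  rewrite (_ : D j n = ~` [set w | (dJ1 (X (dy_after n t) w) (X t w) < j.+1%:R^-1%:E)%E]).
    apply: measurableC; apply: measurable_dJ1_lt; exact: measurable_funPT.
  by apply/seteqP; split=> w /=; rewrite /D /= leNgt => /negP.
apply: (@negligibleS _ _ _ _ (\bigcup_j \bigcup_N \bigcap_(n in [set n | (N <= n)%N]) D j n)).
  move=> w [gw neq]; apply: contrapT => nD; apply: neq.
  apply: J1_separated => e e0; have e20 : 0 < e / 2 by rewrite divr_gt0.
  have [j je] := small_natinv e20; have [N NP] := right_limP t01 t gw e20.
  have [n Nn Dn] : exists2 n, (N <= n)%N & ~ D j n w.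
    apply: contrapT => h; apply: nD; exists j => //; exists N => // n /= Nn.
    by apply: contrapT => Dn; apply: h; exists n.
  have h1 := udist_J1ball (NP n Nn).
  have h2 : J1ball (X (dy_after n t) w) (e / 2) (X t w).
    move/negP: Dn; rewrite -ltNge => /lt_trans; apply.
    by rewrite lte_fin.
  by have := J1ball_triangle (J1ball_sym h1) h2; rewrite -splitr.
apply: negligible_bigcup => j; apply: negligible_bigcup => N.
have mI : measurable (\bigcap_(n in [set n | (N <= n)%N]) D j n).
  by apply: bigcap_measurable => [|n _]; [exists N => /=|exact: mD].
exists (\bigcap_(n in [set n | (N <= n)%N]) D j n); split => //.
apply/le_anti/andP; split; last exact: measure_ge0.
have j0 : (0 : R) < j.+1%:R^-1 by rewrite invr_gt0 ltr0n.
apply: (cvge_to_ge (XP t1 _ j0)); exists N => // n /= Nn.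
by apply: le_measure; rewrite ?inE//; [exact: mD|move=> w; apply].
Qed.

(** The set of bad paths is replaced by a measurable null set, outside of which
    the modification is the right limit along dyadic points. *)
Lemma cadlag_modification X (alpha beta C : R) : 2^-1 < alpha -> 0 <= beta -> 0 <= C ->
  (forall t1 t t2 lambda, t1 <= t -> t <= t2 -> 0 < lambda ->
     (P (two_jumps X lambda t1 t t2) <= ((lambda `^ (4 * beta))^-1
        * (C * (val t2 - val t1)) `^ (2 * alpha))%:E)%E) ->
  (forall t, val t < 1 -> forall eps : R, 0 < eps ->
     P [set w | (eps%:E <= dJ1 (X (dy_after n t) w) (X t w))%E] @[n --> \oo] --> 0%E) ->
  exists Y : I01 R -> {RV P >-> Dspace R},
    (forall w, cadlag (fun t => Y t w)) /\
    forall t, P.-negligible [set w | Y t w <> X t w].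
Proof.
move=> a1 b0 C0 XP XR; have r01 := chain_ratio01 a1 b0.
have K0 : 0 <= (2 * C) `^ (2 * alpha) by exact: powR_ge0.
have [N [mN PN ngoodN]] := ae_good_path r01 K0 (bad_level_prob a1 b0 C0 XP).
have goodN w : ~ N w -> good_path (@udist R) (chain_ratio alpha beta) (fun t => X t w).
  by move=> Nw; apply: contrapT => /ngoodN.
pose f t := (fun w => right_lim (fun t => X t w) t) \_ (~` N).
have fN w t : N w -> f t w = point by move=> Nw; rewrite /f patchC ?setCK ?mem_set.
have fNC w t : ~ N w -> f t w = right_lim (fun t => X t w) t.
  by move=> Nw; rewrite /f patchT// mem_set.
have mf t : measurable_fun setT (f t).
  apply: (@measurable_J1_lim R _ Omega (fun n => X (dy_after n t) \_ (~` N))).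
    move=> n; apply: (iffLR (measurable_restrictT _ (measurableC mN))).
    exact: measurable_funTS (measurable_funPT _).
  move=> w e e0; have [Nw|Nw] := pselect (N w).
    exists 0%N => n _; rewrite fN// patchC ?setCK ?mem_set//; exact: J1ball_center.
  have [M MP] := right_limP r01 t (goodN w Nw) e0; exists M => n /MP h.
  rewrite fNC// patchT ?mem_set//; exact/J1ball_sym/udist_J1ball.
pose Y t : {RV P >-> Dspace R} :=
  HB.pack (f t) (isMeasurableFun.Build _ _ _ _ (f t) (mf t)).
exists Y; split.
  move=> w; change (cadlag (fun t => f t w)); have [Nw|Nw] := pselect (N w).
    rewrite (_ : (fun t => f t w) = fun=> point); last by apply/funext => t; rewrite fN.
    by split=> [t _|t _]; [exact: cvg_cst|exists point; exact: cvg_cst].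
  rewrite (_ : (fun t => f t w) = right_lim (fun t => X t w)).
    exact: (right_lim_cadlag r01 (goodN w Nw)).
  by apply/funext => t; rewrite fNC.
move=> t; apply: negligibleS (negligibleU ((negligibleP _ mN).2 PN)
  (ae_right_lim_eq r01 (XR t))) => w /=.
change (f t w <> X t w -> N w \/
  (good_path (@udist R) (chain_ratio alpha beta) (fun t => X t w) /\
   right_lim (fun t => X t w) t <> X t w)).
have [Nw|Nw] := pselect (N w); first by left.
by rewrite fNC// => neq; right; split=> //; exact: goodN.
Qed.

End modification.

(** * Change of clock *)

Section clock.
Context {R : realType}.
Implicit Types (s t u : I01 R) (g p : I01 R -> I01 R).

(** Adding the identity to [F] makes it strictly increasing, so that it can be
    inverted after normalisation. *)
Lemma clock_exists (F : I01 R -> R) :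
  {homo F : s t / s <= t} -> continuous F ->
  exists C g p, [/\ 0 <= C, {homo g : s t / s < t}, continuous g,
    cancel g p /\ cancel p g &
    forall s t, s <= t -> F t - F s <= C * (val (g t) - val (g s))].
Proof.
move=> hF cF; pose G t := F t + val t.
have hG s t : s < t -> G s < G t.
  by move=> st; apply: ler_ltD; [exact/hF/ltW|exact: st].
pose L := G (clip 1) - G (clip 0).
have L0 : 0 < L by rewrite subr_gt0 hG // ltI01 clip0 clip1 ltr01.
have wG s t : s <= t -> G s <= G t.
  by rewrite le_eqVlt => /orP[/eqP->//|/hG/ltW].
pose h t := (G t - G (clip 0)) / L; pose g t := clip (h t).
have gE t : val (g t) = h t.
  apply: clipK; rewrite divr_ge0 ?(ltW L0) ?subr_ge0 ?wG ?clip0_le//=.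
  by rewrite ler_pdivrMr// mul1r lerB// wG// clip1_ge.
have hg : {homo g : s t / s < t}.
  by move=> s t /hG st; rewrite ltI01 !gE ltr_pM2r ?invr_gt0// ltrD2r.
have cv : continuous (fun t : I01 R => val t).
  move=> t; apply/(@cvgrPdist_lt _ _ _ (nbhs t)) => e e0; rewrite near_simpl.
  by apply/I01_nbhsP; exists e => // s; rewrite distrC.
have cG : continuous G by move=> t; apply: (@cvgD _ _ _ (nbhs t)); [exact: cF|exact: cv].
have ch : continuous h.
  have ck : continuous (fun r : R => (r - G (clip 0)) / L).
    move=> r; apply: cvgM; last exact: cvg_cst.
    by apply: cvgB; [exact: cvg_id|exact: cvg_cst].
  by move=> t; exact: (continuous_comp (cG t) (ck (G t))).
have sg u : exists t, g t = u.
  have [|t ht] := I01_IVT (v := val u) ch.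
    by rewrite /h subrr mul0r divff ?gt_eqF// I01_ge0 I01_le1.
  by exists t; apply: val_inj; rewrite gE.
have [p pK] := choice sg.
have ig : injective g.
  move=> s t gst; case: (ltgtP s t) => // /hg; rewrite gst ltxx //.
exists L, g, p; split => //; first exact: ltW.
- by move=> t; apply: continuous_comp; [exact: ch|exact: clip_continuous].
- by split=> // t; apply: ig; rewrite pK.
- move=> s t st; rewrite !gE /h -mulrBl mulrCA divff ?gt_eqF// mulr1.
  by rewrite opprB addrA subrK /G; move: st; rewrite leI01; lra.
Qed.

Lemma cadlag_comp (T : topologicalType) (x : I01 R -> T) g :
  cadlag x -> {homo g : s t / s < t} -> continuous g -> cadlag (x \o g).
Proof.
move=> [xr xl] hg cg; split=> [t t1|t t0].
  have gt1 : val (g t) < 1.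
    have t1' : t < clip 1 by rewrite ltI01 clip1.
    by apply: lt_le_trans (I01_le1 (g (clip 1))); rewrite -ltI01 hg.
  apply: cvg_comp (xr _ gt1) => A; rewrite /within /= => /(cg t) gA.
  apply: (@filterS _ (nbhs t) _ _ _ _ gA) => s /= gsA ts; apply: gsA; exact: hg.
have gt0 : 0 < val (g t).
  have t0' : clip 0 < t by rewrite ltI01 clip0.
  by apply: le_lt_trans (I01_ge0 (g (clip 0))) _; rewrite -ltI01 hg.
have [l xlP] := xl _ gt0; exists l.
apply: cvg_comp xlP => A; rewrite /within /= => /(cg t) gA.
apply: (@filterS _ (nbhs t) _ _ _ _ gA) => s /= gsA ts; apply: gsA; exact: hg.
Qed.

Lemma inverse_clock_mono g p : {homo g : s t / s < t} -> cancel p g ->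
  forall s t, s <= t -> p s <= p t.
Proof. by move=> hg pK s t; rewrite !leNgt; apply: contra => /hg; rewrite !pK. Qed.

(** The inverse of a clock is continuous from the right because the clock is
    strictly increasing. *)
Lemma inverse_clock_cvg g p (u : nat -> I01 R) u0 : {homo g : s t / s < t} ->
  cancel g p -> cancel p g -> (forall n, u0 <= u n) ->
  (forall e : R, 0 < e -> exists N, forall n, (N <= n)%N -> val (u n) < val u0 + e) ->
  val u0 < 1 -> val (p u0) < 1 /\ p (u n) @[n --> \oo] --> p u0.
Proof.
move=> hg gK pK u0u un u01; have hp := inverse_clock_mono hg pK.
have p1 : val (p u0) < 1.
  have h : u0 < clip 1 by rewrite ltI01 clip1.
  rewrite ltNge; apply/negP => pu.
  have pu1 : p u0 = clip 1 by apply: val_inj; rewrite clip1; apply/le_anti; rewrite pu I01_le1.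
  have : g (clip 1) <= u0 by rewrite -pu1 pK.
  suff -> : g (clip 1) = clip 1 by rewrite leNgt h.
  apply/le_anti; rewrite clip1_ge /=.
  have : (p (clip 1) == clip 1) || (p (clip 1) < clip 1) by rewrite -le_eqVlt clip1_ge.
  move=> /predU1P[|/hg].
    by move=> /(congr1 g); rewrite pK => <-.
  by rewrite pK => /ltW.
split=> // A /I01_nbhsP[e e0 eA].
have [v pv ve] := I01_right p1 e0.
have h0 : 0 < val (g v) - val u0 by rewrite subr_gt0 -ltI01 -[X in X < _]pK hg.
have [N NP] := un _ h0; exists N => // n /= Nn; apply: eA.
have ple : val (p u0) <= val (p (u n)) by rewrite -leI01 hp.
have plt : p (u n) <= v.
  rewrite -[v]gK hp// leI01 ltW//; have := NP n Nn; rewrite addrC subrK//.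
rewrite ger0_norm ?subr_ge0// ltrBlDl; apply: le_lt_trans ve; exact: plt.
Qed.

End clock.

(** The finitely many null sets have a null union, outside of which the two
    tuples are equal. *)
Lemma modification_fdd (R : realType) (d d' : measure_display) (Omega : measurableType d)
    (P : probability Omega R) (D : measurableType d') (k : nat) (X Y : 'I_k -> Omega -> D) :
  (forall i, measurable_fun setT (X i)) -> (forall i, measurable_fun setT (Y i)) ->
  (forall i, P.-negligible [set w | Y i w <> X i w]) ->
  forall B : set (k.-tuple D), measurable B ->
  pushforward P (fun w => [tuple X i w | i < k]) B
    = pushforward P (fun w => [tuple Y i w | i < k]) B.
Proof.
move=> mX mY XY B mB.
have mt (Z : 'I_k -> Omega -> D) : (forall i, measurable_fun setT (Z i)) ->
    measurable ((fun w => [tuple Z i w | i < k]) @^-1` B).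
  move=> mZ; rewrite -[X in measurable X]setTI.
  apply: (_ : measurable_fun setT (fun w => [tuple Z i w | i < k])) => //.
  apply/measurable_fun_tnthP => i.
  rewrite (_ : _ \o _ = Z i)//; apply/funext => w /=; by rewrite tnth_mktuple.
have [N [mN PN eN]] : P.-negligible [set w | ~ forall i, Y i w = X i w].
  exact: (@filter_forall Omega _ (fun i w => Y i w = X i w) (almost_everywhere P) _ XY).
have le (Z Z' : 'I_k -> Omega -> D) : (forall i, measurable_fun setT (Z i)) ->
    (forall i, measurable_fun setT (Z' i)) -> (forall w, ~ N w -> forall i, Z i w = Z' i w) ->
    (P ((fun w => [tuple Z i w | i < k]) @^-1` B)
      <= P ((fun w => [tuple Z' i w | i < k]) @^-1` B))%E.
  move=> mZ mZ' ZZ'.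
  rewrite -[leRHS]adde0 -[X in (_ + X)%E]PN.
  have := measureU2 P (mt _ mZ') mN; apply: le_trans; apply: le_measure; rewrite ?inE.
  - exact: mt.
  - by apply: measurableU; [exact: mt|].
  - move=> w /= Bw; have [Nw|Nw] := pselect (N w); [by right|left].
    suff <- : [tuple Z i w | i < k] = [tuple Z' i w | i < k] by [].
    by apply: eq_mktuple => i; exact: ZZ'.
have NXY w : ~ N w -> forall i, Y i w = X i w.
  by move=> Nw; apply: contrapT => /eN.
apply/le_anti/andP; split; apply: le => // w Nw i; first symmetry; exact: NXY.
Qed.

Unset Implicit Arguments.

Theorem theorem4p7 (R : realType) (d : measure_display)
    (Omega : measurableType d) (P : probability Omega R)
    (X : I01 R -> {RV P >-> Dspace R})
    (condA : exists (alpha beta : R) (F : I01 R -> R),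
      [/\ 2^-1 < alpha, 0 <= beta, {homo F : s t / s <= t}, continuous F &
          forall t1 t t2 : I01 R, t1 <= t -> t <= t2 ->
          forall lambda : R, 0 < lambda ->
            (P [set w | (lambda%:E <=
                  mine (supnorm (fun s => X t w s - X t1 w s)%R)
                       (supnorm (fun s => X t2 w s - X t w s)%R))%E]
             <= ((lambda `^ (4 * beta))^-1
                   * (F t2 - F t1) `^ (2 * alpha))%:E)%E])
    (condB : forall eps : R, 0 < eps ->
      limn_esup (fun n : nat =>
          P [set w | exists i : 'I_(2 ^ n).+1,
                       (eps%:E <= wprime (X (dyadic i) w) delta)%E])
        @[delta --> 0^'+] --> 0%E)
    (condC : forall t : I01 R, val t < 1 ->
      forall t_ : nat -> I01 R, t_ n @[n --> \oo] --> t ->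
      (forall n, t_ n.+1 <= t_ n) ->
      forall eps : R, 0 < eps ->
        P [set w | (eps%:E <= dJ1 (X (t_ n) w) (X t w))%E]
          @[n --> \oo] --> 0%E) :
  exists (d' : measure_display) (Omega' : measurableType d')
         (P' : probability Omega' R) (Y : I01 R -> {RV P' >-> Dspace R}),
    (forall w : Omega', cadlag (fun t => Y t w)) /\
    (forall k : nat, (0 < k)%N -> forall t : 'I_k -> I01 R,
      forall B : set (k.-tuple (Dspace R)), measurable B ->
        pushforward P (fun w => [tuple X (t i) w | i < k]) B =
        pushforward P' (fun w => [tuple Y (t i) w | i < k]) B).
Proof.
have [alpha [beta [F [a1 b0 hF cF XF]]]] := condA.
have [C [g [p [C0 hg cg [gK pK] FC]]]] := clock_exists hF cF.
have hp := inverse_clock_mono hg pK.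
have [|u u1 eps eps0|Y [cY YX]] :=
    @cadlag_modification R d Omega P (X \o p) alpha beta C a1 b0 C0.
- move=> t1 t t2 lambda t1t tt2 l0.
  apply: le_trans (XF _ _ _ (hp _ _ t1t) (hp _ _ tt2) _ l0) _.
  rewrite lee_fin ler_wpM2l ?invr_ge0 ?powR_ge0//.
  have pt12 := hp _ _ (le_trans t1t tt2); have F0 : 0 <= F (p t2) - F (p t1).
    by rewrite subr_ge0 hF.
  have := FC _ _ pt12; rewrite !pK => FC12.
  apply: ge0_ler_powR; rewrite ?nnegrE//; first lra.
  exact: le_trans FC12.
- have [pu1 pcvg] := inverse_clock_cvg hg gK pK (fun n => dy_after_ge n u)
    (fun e e0 => dy_after_near u e0) u1.
  apply: condC => // n; apply: hp; exact: dy_after_nonincreasing.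
exists d, Omega, P, (Y \o g); split=> [w|k _ t B mB].
  exact: (cadlag_comp (cY w) hg cg).
apply: modification_fdd => // i; try exact: measurable_funPT.
by have := YX (g (t i)); rewrite /= gK.
Qed.
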